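(* Consider the multilayer parking system with the three positions $-1,0,1$ described in the context, and for $r\ge 1$ let $\rho^{(r)}:=\lim_{t\to\infty}\rho_t(0,r)$ be the end-density of the center position $0$ in layer $r$. Then $$\lim_{r\to\infty}\rho^{(r)}=\frac12 .$$
   Context: The three-position multilayer parking (particle deposition) system is defined as follows. The sites are pairs $(x,r)$ with position $x\in\{-2,-1,0,1,2\}$ and layer (height) $r\in\{1,2,3,\dots\}$. Particles arrive at the positions $x\in\{-1,0,1\}$ according to independent Poisson processes $(N_t(x))_{t\ge 0}$ of rate $1$, where $N_t(x)$ is the number of arrivals at position $x$ up to time $t$; no particles arrive at the boundary positions: $N_t(-2)=N_t(2)=0$ for all $t$. (Almost surely no two arrivals are simultaneous.) Let $\kappa_t(x,r)=1$ if there is a particle at site $(x,r)$ at time $t$, and $\kappa_t(x,r)=0$ otherwise. At time $0$ all sites are empty. For $x\in\{-1,0,1\}$ let $N_x=\{x-1,x,x+1\}$ be the set consisting of $x$ and the positions at distance $1$ from it. When a particle arrives at position $x$ at time $t$, it is deposited permanently at site $(x,r)$ with $r=h_t(x):=\min\{r\ge 1:\kappa(y,r)=0 \text{ for all } y\in N_x\}$, where $\kappa$ is the configuration immediately before the arrival. (So a particle always goes to the lowest layer in which its own position and the neighboring positions are empty; there is no screening by higher particles.) The density of site $(x,r)$ at time $t$ is $\rho_t(x,r)=\mathbb{E}\,\kappa_t(x,r)$. *)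

(* Defs.v *)
From HB Require Import structures.
From mathcomp Require Import all_boot all_order all_algebra.
From mathcomp Require Import all_classical all_reals all_analysis.

Set Implicit Arguments.
Unset Strict Implicit.
Unset Printing Implicit Defensive.

Import Order.TTheory GRing.Theory Num.Theory.
Import numFieldNormedType.Exports.

Local Open Scope classical_set_scope.
Local Open Scope ring_scope.

Definition independent_events d (T : measurableType d) (R : realType)
    (P : probability T R) (I : finType) (D : {set I})
    (F : I -> set_system T) : Prop :=
  forall (J : {set I}) (A : I -> set T), J \subset D ->
    (forall i, i \in J -> F i (A i)) ->
    P (\bigcap_(i in [set` J]) A i) = (\prod_(i in J) P (A i))%E.

Definition sigma_of T (X : T -> nat) : set_system T :=
  preimage_set_system [set: T] X measurable.

Definition sigma_of_process (R : realType) T (N : R -> T -> nat) :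
    set_system T :=
  <<s \bigcup_(t in [set t : R | 0 <= t]) sigma_of (N t) >>.

Definition counting_path (R : realType) (n : R -> nat) : Prop :=
  [/\ n 0 = 0%N,
      forall s t : R, 0 <= s -> s <= t -> (n s <= n t)%N
    & forall t : R, 0 <= t -> \forall u \near t^'+, n u = n t].

(* The subtraction of naturals is the true increment almost surely, since the
   paths are almost surely nondecreasing. *)
Definition poisson_process d (T : measurableType d) (R : realType)
    (P : probability T R) (rate : R) (N : R -> T -> nat) : Prop :=
  [/\ forall t : R, 0 <= t -> measurable_fun [set: T] (N t),
      {ae P, forall w, counting_path (N ^~ w)},
      forall (s t : R) (k : nat), 0 <= s -> s < t ->
        P [set w | (N t w - N s w)%N = k] =
        (poisson_pmf (rate * (t - s)) k)%:E
    & forall (m : nat) (t : nat -> R), 0 <= t 0%N ->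
        (forall i, (i < m)%N -> t i <= t i.+1) ->
        independent_events P [set: 'I_m]%SET
          (fun i => sigma_of (fun w => (N (t i.+1) w - N (t i) w)%N))].

(* The ordinal i encodes the position i - 2, so that the five ordinals stand
   for the positions -2, -1, 0, 1, 2. *)
Definition position : finType := 'I_5.

Definition coord (x : position) : int := (x : nat)%:Z - 2%:Z.

Definition middle : position := @Ordinal 5 2 isT.

Definition active : {set position} := [set x | `|coord x| <= 1]%SET.

Definition nbhd (x : position) : {set position} :=
  [set y | `|coord x - coord y| <= 1]%SET.

(* Layers are numbered from 1; no particle is ever put in layer 0. *)
Definition config := position -> nat -> bool.

Definition vacant (k : config) (x : position) (r : nat) : bool :=
  [forall y in nbhd x, ~~ k y r].

Definition is_drop_layer (k : config) (x : position) (h : nat) : Prop :=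
  [/\ (1 <= h)%N, vacant k x h
    & forall r, (1 <= r)%N -> vacant k x r -> (h <= r)%N].

Definition deposited (k : config) (x : position) (k' : config) : Prop :=
  exists2 h, is_drop_layer k x h &
    forall y r, k' y r = k y r || ((y == x) && (r == h)).

Definition arrival (R : realType) (n : R -> nat) (t : R) : Prop :=
  0 < t /\ forall s : R, 0 <= s -> s < t -> (n s < n t)%N.

(* In the last clause, the configuration immediately before an arrival is
   the common value of k s for s < t close to t.  The clause cannot hold at a
   simultaneous arrival at two positions, which has probability zero. *)
Definition parking_path (R : realType)
    (n : position -> R -> nat) (k : R -> config) : Prop :=
  [/\ forall x r, k 0 x r = false,
      forall s t : R, 0 <= s -> s <= t ->
        (forall x (u : R), s < u -> u <= t -> ~ arrival (n x) u) ->
        forall y r, k t y r = k s y r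
    & forall x t, arrival (n x) t ->
        \forall s \near t^'-, deposited (k s) x (k t)].

Definition parking_system d (T : measurableType d) (R : realType)
    (P : probability T R) (N : position -> R -> T -> nat)
    (kappa : R -> T -> config) : Prop :=
  [/\ forall x, x \in active -> poisson_process P 1 (N x),
      independent_events P active (fun x => sigma_of_process (N x)),
      forall x (t : R) w, x \notin active -> 0 <= t -> N x t w = 0%N,
      forall (t : R) x r, 0 <= t ->
        measurable_fun [set: T] (fun w => kappa t w x r)
    & {ae P, forall w, parking_path (fun x t => N x t w) (kappa ^~ w)}].

Definition density d (T : measurableType d) (R : realType)
    (P : probability T R) (kappa : R -> T -> config)
    (t : R) (x : position) (r : nat) : \bar R :=
  'E_P[fun w => (kappa t w x r)%:R].

Definition end_density d (T : measurableType d) (R : realType)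
    (P : probability T R) (kappa : R -> T -> config) (r : nat) : \bar R :=
  lim (density P kappa t middle r @[t --> +oo%R]).

(* Main.v *)
Require Import Defs.
From HB Require Import structures.
From mathcomp Require Import all_boot all_order all_algebra.
From mathcomp Require Import all_classical all_reals all_analysis.
From mathcomp Require Import zify ring lra.

Import Order.TTheory GRing.Theory Num.Theory.
Import numFieldNormedType.Exports.

Local Open Scope classical_set_scope.
Local Open Scope ring_scope.

(** Let L, C, M be the numbers of arrivals at -1, 0, 1 up to time s.  Every
    occupied layer holds either one particle at the centre or particles at the
    sides only.  An arrival at a side finds a free place below the top exactly
    when the other side has received more particles; otherwise it opens a new
    layer.  An arrival at the centre always opens a new layer.  Hence the
    occupied layers are 1, ..., H with H = C + max(L, M), in whatever order the
    particles came, and layer r + 1 has a centre particle if and only if H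
    passes from r to r + 1 by an arrival at the centre ([stacked_side],
    [stacked_middle]).

    While H = r, the process C jumps at rate 1, and max(L, M) jumps at rate 1
    if L and M differ but at rate 2 if they agree.  So the quantity
      [balance] r s =
        2 P(layer r + 1 has a centre particle at time s) - P(H_s > r)
    has derivative - P(H_s = r, L_s = M_s).  It starts at 0 and decreases,
    which bounds the end-density by 1/2.  For the other direction the total
    loss has to be small.  Up to a fixed time t0 it is at most P(H_t0 > r),
    which tends to 0 as r grows.  After t0, independence gives
      P(H_s = r, L_s = M_s) = sum_m P(L_s = m) P(C_s = r - m) P(M_s = m)
                            <= sup_m P(L_s = m) * P(C_s + M_s = r),
    where the supremum is small because the Poisson law spreads out
    ([poisson_pmf_small]), and the integral of P(C_s + M_s = r) over s is at
    most 1, since C + M leaves r for ever at least at the rate of C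
    ([tied_jump_bound]).

    In place of derivatives, time is cut into short cells from s to u.  A cell with at most one arrival changes every quantity
    in an explicit way ([layer_balance]); two arrivals in a cell have
    probability at most 6 (u - s)^2 ([pr_two_arrivals]); and a function whose
    increments are bounded above by a multiple of (u - s)^2 is nonincreasing
    ([nonincreasing_quadratic]).  The same estimate shows that almost every
    path admits a grid with at most one arrival in each cell, and an induction
    along this grid yields the description of the occupied layers at a given
    time ([ae_stacked]). *)

Set Implicit Arguments.
Unset Strict Implicit.
Unset Printing Implicit Defensive.

(** * Layers of a configuration *)

Definition leftpos : position := @Ordinal 5 1 isT.
Definition rightpos : position := @Ordinal 5 3 isT.

Lemma vacant_middle k j :
  vacant k middle j = [&& ~~ k leftpos j, ~~ k middle j & ~~ k rightpos j].
Proof.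
apply/forallP/and3P => [v|[l c r] y].
  by split; [move: (v leftpos)|move: (v middle)|move: (v rightpos)];
    rewrite !inE.
apply/implyP; rewrite !inE.
case: y => -[|[|[|[|[|//]]]]] i //= _.
- by rewrite (_ : Ordinal i = leftpos)//; exact/val_inj.
- by rewrite (_ : Ordinal i = middle)//; exact/val_inj.
- by rewrite (_ : Ordinal i = rightpos)//; exact/val_inj.
Qed.

Lemma vacant_side k x j : x \in [:: leftpos; rightpos] ->
  (forall y i, y \notin active -> k y i = false) ->
  vacant k x j = ~~ k x j && ~~ k middle j.
Proof.
move=> xs k0; apply/forallP/andP => [v|[kx km] y].
  move: (v x) (v middle); rewrite !inE subrr normr0 /= => -> w; split=> //.
  by move: xs w; rewrite !inE => /orP[] /eqP ->.
apply/implyP; rewrite inE.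
case: (boolP (y \in active)) => [|/k0 ->//].
move: xs kx; rewrite !inE => /orP[] /eqP ->;
case: y => -[|[|[|[|[|//]]]]] i //= kx _ _.
- by rewrite (_ : Ordinal i = leftpos)//; exact/val_inj.
- by rewrite (_ : Ordinal i = middle)//; exact/val_inj.
- by rewrite (_ : Ordinal i = middle)//; exact/val_inj.
- by rewrite (_ : Ordinal i = rightpos)//; exact/val_inj.
Qed.

Definition column_count (k : config) (x : position) (h : nat) : nat :=
  (\sum_(1 <= j < h.+1) k x j)%N.

(** The number of occupied layers after l, c, m arrivals at one side, the centre
    and the other side: each centre particle has a layer of its own, and side
    particles share layers as far as possible. *)
Definition layers (l c m : nat) : nat := (c + maxn l m)%N.

(** The invariant of the dynamics.  The two sides x and y are arguments so that
    one argument serves both ([stackedC]). The counts alone determine which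
    arrivals open a new layer, so nothing is recorded about which layers hold
    one or two side particles. *)
Record stacked (k : config) (x y : position) (l c m : nat) : Prop := Stacked {
  stacked_boundary : forall z j, z \notin active -> k z j = false ;
  stacked_exclusion : forall j, k middle j -> ~~ k x j && ~~ k y j ;
  stacked_occupied : forall j,
    [|| k x j, k middle j | k y j] = (1 <= j <= layers l c m)%N ;
  stacked_count : [/\ column_count k x (layers l c m) = l,
    column_count k middle (layers l c m) = c &
    column_count k y (layers l c m) = m] }.

Lemma stackedC k x y l c m : stacked k x y l c m -> stacked k y x m c l.
Proof.
move=> [b e o [cx cm cy]].
have hE : layers m c l = layers l c m by rewrite /layers maxnC.
split=> //; rewrite ?hE //.
- by move=> j /e; rewrite andbC.
- by move=> j; rewrite -o; do 3![case: (k _ _)].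
Qed.

Lemma stacked_empty k x y : (forall z j, k z j = false) -> stacked k x y 0 0 0.
Proof.
move=> k0; split=> //.
- by move=> j; rewrite !k0.
- by move=> j; rewrite !k0; case: j.
- by rewrite /column_count !big_geq.
Qed.

Lemma eq_column_count k k' x h :
  (forall j, k' x j = k x j) -> column_count k' x h = column_count k x h.
Proof. by move=> kk; apply: eq_bigr => j _; rewrite kk. Qed.

Lemma column_count_add k k' x h i :
  (forall j, k' x j = k x j || (j == i)) -> k x i = false ->
  (1 <= i <= h)%N -> column_count k' x h = (column_count k x h).+1.
Proof.
move=> kk ki /andP[i1 ih]; rewrite /column_count.
have -> : (\sum_(1 <= j < h.+1) k' x j = \sum_(1 <= j < h.+1) (k x j + (j == i)))%N.
  apply: eq_bigr => j _; rewrite kk.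
  by case: eqVneq => [->|]; rewrite ?ki // orbF addn0.
have one : (\sum_(1 <= j < h.+1) (j == i) = 1)%N.
  rewrite (bigD1_seq i) ?iota_uniq ?mem_index_iota ?i1//= eqxx big1// => j.
  by move=> /negbTE ->.
by rewrite big_split /= one addn1.
Qed.

Lemma column_countS k x h :
  k x h.+1 = false -> column_count k x h.+1 = column_count k x h.
Proof. by move=> kx; rewrite /column_count big_nat_recr//= kx addn0. Qed.

(** Each of the c + max(l, m) occupied layers holds a particle at x, a particle at
    the centre, or is open to an arrival at x; the first two kinds are exclusive
    and there are l and c of them.  So x opens a new layer iff m <= l. *)
Lemma stacked_free k x y l c m : stacked k x y l c m ->
  (\sum_(1 <= j < (layers l c m).+1) (~~ k x j && ~~ k middle j) = maxn l m - l)%N.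
Proof.
case=> _ e o [cx cm cy]; set h := layers l c m in o cx cm cy *.
have : (\sum_(1 <= j < h.+1) (k x j + k middle j +
    (~~ k x j && ~~ k middle j)) = h)%N.
  rewrite -[RHS](subn0) -[RHS]subSS -[RHS]muln1 -sum_nat_const_nat.
  apply: eq_bigr => j _; have := e j.
  by case: (k x j); case: (k middle j) => // /(_ isT).
rewrite !big_split /= -/(column_count k x h) -/(column_count k middle h) cx cm.
by rewrite /h /layers => ?; lia.
Qed.

(** An occupied layer is never vacant for the centre. *)
Lemma stacked_middle k k' l c m : stacked k leftpos rightpos l c m ->
  deposited k middle k' ->
  stacked k' leftpos rightpos l c.+1 m /\
  forall j, k' middle j = k middle j || (j == (layers l c m).+1).
Proof.
case=> b e o [cx cm cy] [h [h1 vh minh] kk].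
have hE : h = (layers l c m).+1.
  apply/eqP; rewrite eqn_leq minh//=.
    by move: vh; have := o h; rewrite h1 vacant_middle ltnNge /= => <-; do 3![case: (k _ _)].
  by have := o (layers l c m).+1; rewrite vacant_middle ltnn; do 3![case: (k _ _)].
have H' : layers l c.+1 m = (layers l c m).+1 by [].
have km j : k' middle j = k middle j || (j == h) by rewrite kk eqxx.
have kx j : k' leftpos j = k leftpos j by rewrite kk orbF.
have ky j : k' rightpos j = k rightpos j by rewrite kk orbF.
have := o h; rewrite hE ltnn /= => /norP[klh /norP[kmh krh]].
rewrite -hE in klh kmh krh.
split; last by move=> j; rewrite km hE.
split.
- move=> z j za; rewrite kk b//=; case: eqP za => // ->; by rewrite inE.
- move=> j; rewrite km kx ky => /orP[/e//|/eqP->]; by rewrite klh.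
- by move=> j; rewrite kx ky km H' (leq_eqVlt j) ltnS andb_orr -o hE; case: eqP => [->|_]; rewrite ?andbF; do 3![case: (k _ _)].
- rewrite H' (eq_column_count _ kx) (eq_column_count _ ky).
  rewrite (column_count_add km) ?(negbTE kmh)// -?hE ?h1 ?leqnn//.
  by rewrite hE !column_countS -?hE ?(negbTE klh) ?(negbTE kmh) ?(negbTE krh)// cm.
Qed.

(** If l < m, some layer below the top is open to x, and the particle lands there
    without changing the number of layers c + m; otherwise it opens a layer. *)
Lemma stacked_side k k' x y l c m : stacked k x y l c m ->
  x \in [:: leftpos; rightpos] -> y \in [:: leftpos; rightpos] -> x != y ->
  deposited k x k' ->
  stacked k' x y l.+1 c m /\ forall j, k' middle j = k middle j.
Proof.
move=> S xs ys xy [h [h1 vh minh] kk].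
have free := stacked_free S.
case: S => b e o [cx cm cy].
have vac j := vacant_side j xs b.
have xm : (middle == x) = false by move: xs; rewrite !inE => /orP[]/eqP->.
have kx j : k' x j = k x j || (j == h) by rewrite kk eqxx.
have km j : k' middle j = k middle j by rewrite kk xm orbF.
have ky j : k' y j = k y j by rewrite kk eq_sym (negbTE xy) orbF.
move: vh; rewrite vac => /andP[kxh kmh].
have xa : x \in active by move: xs; rewrite !inE => /orP[]/eqP->.
split=> //.
have bd z j : z \notin active -> k' z j = false.
  by move=> za; rewrite kk b//=; case: eqP za => // ->; rewrite xa.
have ex j : k' middle j -> ~~ k' x j && ~~ k' y j.
  rewrite km kx ky; case: eqP => [->|_]; first by rewrite (negbTE kmh).
  by rewrite orbF; exact: e.
case: (ltnP l m) => lm.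
  have H' : layers l.+1 c m = layers l c m by rewrite /layers; lia.
  have hH : (h <= layers l c m)%N.
    rewrite leqNgt; apply/negP => Hh; move: free; rewrite big_nat big1; first lia.
    move=> j /andP[j1 jH]; apply/eqP; rewrite eqb0 -vac; apply/negP => /(minh _ j1); lia.
  split=> //.
  - move=> j; rewrite kx km ky H' -o; case: eqP => [->|_]; last by rewrite orbF.
    by rewrite o h1 hH orbT.
  - rewrite H' (eq_column_count _ km) (eq_column_count _ ky).
    by rewrite (column_count_add kx) ?h1 ?(negbTE kxh)// cx.
have H' : layers l.+1 c m = (layers l c m).+1 by rewrite /layers; lia.
have hE : h = (layers l c m).+1.
  apply/eqP; rewrite eqn_leq minh//=; last first.
    by have := o (layers l c m).+1; rewrite ltnn vac; do 3![case: (k _ _)].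
  rewrite ltnNge; apply/negP => hH.
  move: free; rewrite (bigD1_seq h) ?iota_uniq ?mem_index_iota ?h1//= kxh kmh; lia.
have := o h; rewrite hE ltnn /= => /norP[_ /norP[_ kyh]].
split=> //.
- move=> j; rewrite kx ky km H' (leq_eqVlt j) ltnS andb_orr -o hE.
  by case: eqP => [->|_]; rewrite ?andbF; do 3![case: (k _ _)].
- rewrite H' (eq_column_count _ km) (eq_column_count _ ky).
  rewrite (column_count_add kx) ?(negbTE kxh)// -?hE ?h1 ?leqnn//.
  by rewrite hE !column_countS -?hE ?(negbTE kxh) ?(negbTE kmh)// ?cx// hE; exact/negbTE.
Qed.

(** * Paths *)

Lemma active_left : leftpos \in active. Proof. by rewrite inE. Qed.
Lemma active_middle : middle \in active. Proof. by rewrite inE. Qed.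
Lemma active_right : rightpos \in active. Proof. by rewrite inE. Qed.
#[local] Hint Resolve active_left active_middle active_right : core.

(** The arrival is the infimum of the times at which n has left its value at s;
    right-continuity puts the jump at that time and not after it. *)
Lemma first_jump (R : realType) (n : R -> nat) (s u : R) :
  counting_path n -> 0 <= s -> s < u -> n u = (n s).+1 ->
  exists v, [/\ s < v, v <= u,
    forall w, s <= w -> w < v -> n w = n s &
    forall w, v <= w -> w <= u -> n w = n u].
Proof.
move=> [_ mono rc] s0 su nu.
pose J := [set w : R | s < w /\ w <= u /\ (n s < n w)%N].
have Ju : J u by rewrite /J /= su lexx nu ltnS leqnn.
have infJ : has_inf J.
  by split; [exists u | exists s => w [/ltW]].
pose v := inf J.
have sv : s <= v by apply: lb_le_inf; [exists u | move=> w [/ltW]].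
have vu : v <= u by apply: ge_inf => //; case: infJ.
have before w : s <= w -> w < v -> n w = n s.
  move=> sw wv; apply/eqP; rewrite eqn_leq (mono s w)// andbT leqNgt; apply/negP => nsw.
  have sw' : s < w.
    by rewrite lt_neqAle sw andbT; apply/eqP => sE; rewrite sE ltnn in nsw.
  have : v <= w; last by rewrite leNgt wv.
  apply: ge_inf; first by case: infJ.
  by split=> //; split=> //; apply: ltW; apply: lt_le_trans wv vu.
have v0 : 0 <= v by apply: le_trans sv.
have nv : (n s < n v)%N.
  have [e /= e0 he] := rc v v0.
  have [w [sw [wu nsw]] wve] := inf_adherent e0 infJ.
  have : v <= w by apply: ge_inf => //; case: infJ.
  rewrite le_eqVlt => /predU1P[->//|vw].
  rewrite -(he w)//=; rewrite ltr0_norm ?subr_lt0// opprB ltrBlDl.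
  exact: wve.
have sv' : s < v.
  by rewrite lt_neqAle sv andbT; apply/eqP => sE; rewrite sE ltnn in nv.
exists v; split=> // w vw wu.
apply/eqP; rewrite eqn_leq (mono w u)//; last exact: le_trans vw.
by rewrite nu (leq_trans nv)// mono.
Qed.

Definition increment (R : realType) (n : position -> R -> nat) (s u : R) x : nat :=
  (n x u - n x s)%N.

Definition arrivals (R : realType) (n : position -> R -> nat) (s u : R) : nat :=
  (increment n s u leftpos + increment n s u middle + increment n s u rightpos)%N.

Definition good_path (R : realType) (n : position -> R -> nat) (k : R -> config) :=
  [/\ parking_path n k, forall x, x \in active -> counting_path (n x)
    & forall x t, x \notin active -> 0 <= t -> n x t = 0%N].

Lemma no_arrival (R : realType) (n : R -> nat) (s u v : R) :
  0 <= s -> s < v -> v <= u -> (forall w, s <= w -> w <= u -> n w = n s) ->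
  ~ arrival n v.
Proof.
move=> s0 sv vu nE [v0 /(_ s s0 sv)]; rewrite nE ?ltnn//; exact: ltW.
Qed.

Lemma activeE x : x \in active -> x \in [:: leftpos; middle; rightpos].
Proof.
by rewrite !inE; case: x => -[|[|[|[|[|//]]]]] i; rewrite -!(inj_eq val_inj).
Qed.

Lemma constant_between (R : realType) (n : R -> nat) (s u w : R) :
  counting_path n -> 0 <= s -> n u = n s -> s <= w -> w <= u -> n w = n s.
Proof.
move=> [_ mono _] s0 nu sw wu; apply/eqP.
by rewrite eqn_leq (mono s w)// andbT -nu mono// (le_trans s0).
Qed.

(** With at most one arrival between s and u, the configuration just before that
    arrival is the one at time s and the configuration just after it is the one
    at time u. *)
Lemma config_step (R : realType) n (k : R -> config) (s u : R) :
  good_path n k -> 0 <= s -> s < u -> (arrivals n s u <= 1)%N ->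
  ((forall x, x \in active -> n x u = n x s) /\ k u = k s) \/
  exists2 x, x \in active & [/\ n x u = (n x s).+1,
    forall y, y \in active -> y != x -> n y u = n y s &
    deposited (k s) x (k u)].
Proof.
move=> [[_ stay dep] cnt bd] s0 su A.
have mono x : x \in active -> (n x s <= n x u)%N.
  by move=> /cnt[_ m _]; apply: m => //; exact: ltW.
have ml := mono leftpos active_left; have mm := mono middle active_middle.
have mr := mono rightpos active_right.
have stayE (a b : R) : 0 <= a -> a <= b ->
    (forall x, x \in active -> forall w, a <= w -> w <= b -> n x w = n x a) ->
    k b = k a.
  move=> a0 ab c; apply/funext => y; apply/funext => r.
  apply: stay => // x v av vb; apply: (no_arrival a0 av vb).
  move=> w aw wb; case: (boolP (x \in active)) => xa; first exact: c.
  by rewrite !bd// (le_trans a0).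
case: (pselect (forall x, x \in active -> n x u = n x s)) => [same|].
  left; split=> //; apply: stayE => //; first exact: ltW.
  move=> x xa w sw wu; apply: constant_between sw wu => //; first exact: cnt.
  exact: same.
move=> /existsNP[x /not_implyP[xa /eqP nx]]; right; exists x => //.
have [nxu ny] : n x u = (n x s).+1 /\
    forall y, y \in active -> y != x -> n y u = n y s.
  move: nx A; rewrite /arrivals /increment.
  have := activeE xa; rewrite !inE => /or3P[] /eqP-> nx A; split; try lia;
    move=> y /activeE; rewrite !inE => /or3P[] /eqP-> //; lia.
split=> //.
have [v [sv vu bef aft]] := first_jump (cnt x xa) s0 su nxu.
have v0 : 0 < v by apply: le_lt_trans sv.
have arr : arrival (n x) v.
  split=> // w w0 wv; rewrite (aft v)// nxu ltnS.
  case: (leP w s) => ws; first by case: (cnt x xa) => _ m _; apply: m.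
  by rewrite (bef w)// ltW.
have const (a b : R) : s <= a -> a <= b -> b <= u ->
    (forall w, a <= w -> w <= b -> n x w = n x a) -> k b = k a.
  move=> sa ab bu xc; apply: stayE => //; first exact: le_trans sa.
  move=> y ya w aw wb; case: (eqVneq y x) => [->|yx]; first exact: xc.
  have nyc z : s <= z -> z <= u -> n y z = n y s.
    by apply: constant_between; [exact: cnt | | exact: ny].
  rewrite !nyc//; [exact: le_trans ab bu | exact: le_trans aw | exact: le_trans bu].
have kuv : k u = k v.
  apply: const => //; [exact: ltW | move=> w vw wu].
  by rewrite !aft.
have [w [sw wv] dw] : exists2 w, s < w /\ w < v & deposited (k w) x (k v).
  have h : \forall w \near v^'-, (s < w /\ w < v) /\ deposited (k w) x (k v).
    near=> w; split; last by near: w; exact: dep.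
    split; near: w; [exact: nbhs_left_gt | exact: nbhs_left_lt].
  have [w [? ?]] := filter_ex h; by exists w.
rewrite kuv -(_ : k w = k s)//; apply: const => //; [exact: ltW| |].
  by apply/ltW/(lt_le_trans wv).
move=> z sz zw; apply: bef => //; exact: le_lt_trans wv.
Unshelve. all: by end_near.
Qed.

Definition stacked_at (R : realType) (n : position -> R -> nat) (k : R -> config) (s : R) :=
  stacked (k s) leftpos rightpos (n leftpos s) (n middle s) (n rightpos s).

Definition height (R : realType) (n : position -> R -> nat) (s : R) : nat :=
  layers (n leftpos s) (n middle s) (n rightpos s).

Lemma stacked_step (R : realType) n (k : R -> config) (s u : R) :
  good_path n k -> 0 <= s -> s < u -> (arrivals n s u <= 1)%N ->
  stacked_at n k s -> stacked_at n k u /\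
  forall j, k u middle j = k s middle j ||
     ((j == (height n s).+1) && (n middle s < n middle u)%N).
Proof.
move=> G s0 su A S; rewrite /stacked_at.
case: (config_step G s0 su A) => [[nE ->]|[x /activeE]].
  by rewrite !nE//; split=> // j; rewrite ltnn andbF orbF.
rewrite !inE => /or3P[] /eqP-> [nx ny D].
- have [S' m'] := stacked_side S isT isT isT D.
  by rewrite nx !(ny middle, ny rightpos)//; split=> // j; rewrite ltnn andbF orbF.
- have [S' m'] := stacked_middle S D.
  by rewrite nx !(ny leftpos, ny rightpos)//; split=> // j; rewrite ltnS leqnn andbT.
- have [S' m'] := stacked_side (stackedC S) isT isT isT D.
  rewrite nx !(ny leftpos, ny middle)//; split; first exact/stackedC.
  by move=> j; rewrite ltnn andbF orbF.
Qed.

(** A grid with at most one arrival per cell replaces an enumeration of the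
    arrival times in the induction over arrivals. *)
Lemma stacked_grid (R : realType) n (k : R -> config) (s : R) (m : nat) :
  good_path n k -> 0 <= s -> (0 < m)%N ->
  (forall i, (i < m)%N -> (arrivals n (s * i%:R / m%:R) (s * i.+1%:R / m%:R) <= 1)%N) ->
  stacked_at n k s.
Proof.
move=> G s0 m0 A.
have st0 : stacked_at n k 0.
  case: G => -[k0 _ _] cnt _; rewrite /stacked_at.
  have z x : x \in active -> n x 0 = 0%N by move=> /cnt[].
  by rewrite !z//; exact: stacked_empty.
move: s0; rewrite le_eqVlt => /predU1P[<-//|s0].
have : forall i, (i <= m)%N -> stacked_at n k (s * i%:R / m%:R).
  elim=> [|i IH] im; first by rewrite mulr0 mul0r.
  apply: (stacked_step G _ _ (A i im) (IH (ltnW im))).1.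
    by rewrite divr_ge0// mulr_ge0// ltW.
  by rewrite ltr_pM2r ?invr_gt0 ?ltr0n// ltr_pM2l// ltr_nat.
by move=> /(_ m (leqnn _)); rewrite mulfK// pnatr_eq0 -lt0n.
Qed.

(** * Real estimates *)

(** Cutting the interval from a to b into n cells bounds f b - f a by
    c (b - a)^2 / n. *)
Lemma nonincreasing_quadratic (R : realType) (f : R -> R) (c a b : R) :
  a <= b ->
  (forall s u, a <= s -> s < u -> u <= b -> f u - f s <= c * (u - s) ^+ 2) ->
  f b <= f a.
Proof.
move=> ab fc; rewrite leNgt; apply/negP => fab.
have {}ab : a < b.
  by rewrite lt_neqAle ab andbT; apply: contraTneq fab => ->; rewrite ltxx.
pose e := f b - f a; have e0 : 0 < e by rewrite subr_gt0.
pose K := c * (b - a) ^+ 2.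
have [n nK] : exists n : nat, K / e < n.+1%:R.
  exists (Num.truncn `|K / e|); apply: le_lt_trans (ler_norm _) _.
  by rewrite truncnS_gt.
pose h := (b - a) / n.+1%:R.
have n0 : 0 < n.+1%:R :> R by rewrite ltr0n.
have h0 : 0 < h by rewrite divr_gt0// subr_gt0.
have hn : h * n.+1%:R = b - a by rewrite /h mulfVK// gt_eqF.
have step : forall i, (i <= n.+1)%N -> f (a + h * i%:R) - f a <= i%:R * (c * h ^+ 2).
  elim=> [|i IH] im; first by rewrite mulr0 addr0 subrr mul0r.
  have sa : a <= a + h * i%:R by rewrite lerDl mulr_ge0// ltW.
  have su : a + h * i%:R < a + h * i.+1%:R.
    by rewrite ltrD2l ltr_pM2l// ltr_nat.
  have ub : a + h * i.+1%:R <= b.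
    by rewrite -lerBrDl -hn ler_pM2l// ler_nat.
  have := fc _ _ sa su ub.
  have -> : a + h * i.+1%:R - (a + h * i%:R) = h by rewrite -natr1; ring.
  have := IH (ltnW im); rewrite -natr1; lra.
have := step n.+1 (leqnn _); rewrite hn (_ : a + (b - a) = b); last by ring.
rewrite -/e.
have -> : n.+1%:R * (c * h ^+ 2) = K / n.+1%:R.
  by rewrite /K /h; field; rewrite gt_eqF.
rewrite ler_pdivlMr// => le1.
by move: nK; rewrite ltr_pdivrMr// mulrC ltNge le1.
Qed.

(** The bound (2m + 1)^(-1/2) for the central binomial coefficient of order m over
    4^m, squared and cleared of denominators.  From m to m + 1 the left side gains
    (2m + 1) (2m + 3) (2m + 2)^2 and the right side (2m + 2)^4. *)
Lemma central_binomial_bound m :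
  (m.*2.+1 * m.*2`! ^ 2 <= m`! ^ 4 * 16 ^ m)%N.
Proof.
elim: m => // m IH.
have -> : (m.+1.*2.+1 * m.+1.*2`! ^ 2 =
   (m.*2.+3 * m.*2.+1 * m.*2.+2 ^ 2) * (m.*2.+1 * m.*2`! ^ 2))%N.
  rewrite doubleS !factS; ring.
have -> : (m.+1`! ^ 4 * 16 ^ m.+1 = (m.*2.+2 ^ 4) * (m`! ^ 4 * 16 ^ m))%N.
  by rewrite factS (expnS 16) (_ : m.*2.+2 = 2 * m.+1)%N; [ring | lia].
apply: leq_mul => //; rewrite (expnD _ 2 2) leq_mul2r; apply/orP; right; nia.
Qed.

Section poisson_pmf_bounds.
Context (R : realType).
Implicit Types (t eps : R) (m : nat).

Lemma poisson_pmf_le1 t m : poisson_pmf t m <= 1.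
Proof.
rewrite /poisson_pmf; case: ifP => // t0.
rewrite expRN ler_pdivrMr ?expR_gt0// mul1r.
have := @expR_ge1Dxn R t m.-1 (ltW t0).
case: m => [|m] /=; last by move=> h; apply: le_trans h; rewrite lerDr.
by move=> _; rewrite expr0 fact0 invr1 mulr1 -expR0 ler_expR ltW.
Qed.

(** The ratio of the masses at m and m + 1 is (m + 1) / t. *)
Lemma poisson_pmf_le_div t m : 0 < t -> poisson_pmf t m <= m.+1%:R / t.
Proof.
move=> t0; rewrite ler_pdivlMr//.
have -> : poisson_pmf t m * t = m.+1%:R * poisson_pmf t m.+1.
  rewrite /poisson_pmf t0 factS natrM exprS; field.
  by rewrite nat1r !pnatr_eq0 /= -lt0n fact_gt0.
by rewrite ler_piMr// poisson_pmf_le1.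
Qed.

(** The square of the mass at m for rate t is the mass at 2m for rate 2t, which is
    at most 1, times the central binomial coefficient over 4^m. *)
Lemma poisson_pmf_expr4_bound t m :
  0 < t -> m.*2.+1%:R * poisson_pmf t m ^+ 4 <= 1.
Proof.
move=> t0.
have t20 : 0 < t *+ 2 by rewrite mulrn_wgt0.
set F : R := m`!%:R; set G : R := m.*2`!%:R.
have F0 : 0 < F by rewrite ltr0n fact_gt0.
have G0 : 0 < G by rewrite ltr0n fact_gt0.
have E : poisson_pmf t m ^+ 2 * (F ^+ 2 * 4 ^+ m) = poisson_pmf (t *+ 2) m.*2 * G.
  rewrite /poisson_pmf t0 t20 -/F -/G.
  have -> : expR (- (t *+ 2)) = expR (- t) ^+ 2.
    by rewrite expr2 -expRD; congr expR; ring.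
  have -> : (t *+ 2) ^+ m.*2 = 4 ^+ m * (t ^+ m) ^+ 2.
    rewrite -mul2n exprM (_ : (t *+ 2) ^+ 2 = 4 * t ^+ 2); last by ring.
    by rewrite exprMn -!exprM mulnC.
  by field; rewrite !gt_eqF.
have b1 : poisson_pmf t m ^+ 2 * (F ^+ 2 * 4 ^+ m) <= G.
  by rewrite E ler_piMl ?poisson_pmf_le1// ltW.
have b0 : 0 <= poisson_pmf t m ^+ 2 * (F ^+ 2 * 4 ^+ m).
  by rewrite E mulr_ge0 ?poisson_pmf_ge0// ltW.
have b2 : (poisson_pmf t m ^+ 2 * (F ^+ 2 * 4 ^+ m)) ^+ 2 <= G ^+ 2.
  by rewrite lerXn2r// nnegrE// ltW.
have b3 : m.*2.+1%:R * G ^+ 2 <= F ^+ 4 * 16 ^+ m.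
  by rewrite /F /G -!natrX -!natrM ler_nat central_binomial_bound.
have D0 : 0 < F ^+ 4 * 16 ^+ m by rewrite mulr_gt0// exprn_gt0.
rewrite -(ler_pM2r D0) mul1r; apply: le_trans b3.
rewrite -mulrA ler_pM2l ?ltr0n//; apply: le_trans b2.
have -> : (16 : R) = 4 ^+ 2 by rewrite -natrX.
rewrite -exprM [(2 * m)%N]mulnC exprM le_eqVlt; apply/orP; left; apply/eqP; ring.
Qed.

(** Small m is covered by [poisson_pmf_le_div] with t large, large m by
    [poisson_pmf_expr4_bound] uniformly in t. *)
Lemma poisson_pmf_small eps : 0 < eps ->
  exists2 t0, 0 < t0 & forall t m, t0 <= t -> poisson_pmf t m <= eps.
Proof.
move=> e0; pose M := (Num.truncn (eps ^- 4)).+1.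
have M0 : (0 < M%:R :> R) by rewrite ltr0n.
exists (M%:R / eps); first exact: divr_gt0.
move=> t m tM; have t0 : 0 < t by apply: lt_le_trans tM; exact: divr_gt0.
case: (ltnP m M) => mM.
  apply: (le_trans (poisson_pmf_le_div m t0)).
  rewrite ler_pdivrMr// -ler_pdivrMl// mulrC; apply: le_trans tM.
  by rewrite ler_pM2r ?invr_gt0// ler_nat.
rewrite leNgt; apply/negP => em.
have := poisson_pmf_expr4_bound m t0; apply/negP; rewrite -ltNge.
have p0 : 0 < eps ^+ 4 by rewrite exprn_gt0.
have h : 1 < m.*2.+1%:R * eps ^+ 4.
  rewrite -ltr_pdivrMr// mul1r; apply: (lt_trans (truncnS_gt _)).
  by rewrite ltr_nat ltnS -addnn (leq_trans mM)// leq_addr.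
apply: lt_trans h _.
by rewrite ltr_pM2l ?ltr0n// ltrXn2r// ltW.
Qed.

End poisson_pmf_bounds.

(** * Probabilities of boolean events *)

Section observables.
Context (T : Type) (G : set_system T) (sG : sigma_algebra [set: T] G).

(** Measurability of a discrete variable, with respect to a family of sets rather
    than a measurable type: the same lemmas then serve the whole space and the
    sigma-algebra of a single process. *)
Definition observable (A : Type) (X : T -> A) := forall a, G [set w | X w = a].

Lemma sigma_algebra_setI U V : G U -> G V -> G (U `&` V).
Proof.
case: sG => _ GC GU gU gV.
rewrite -(setCK (U `&` V)) setCI -setTD -bigcup2inE.
apply: (GC); have -> : \bigcup_(i < 2) bigcup2 (~` U) (~` V) i =
    \bigcup_i (if (i < 2)%N then bigcup2 (~` U) (~` V) i else set0).
  rewrite eqEsubset; split=> w [i].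
    by move=> /= i2 iw; exists i => //; rewrite i2.
  by case: ifP => // i2 _ iw; exists i.
apply: GU => -[|[|i]] /=; rewrite -?setTD; [exact: GC| exact: GC | by case: sG].
Qed.

Lemma observable_op2 (A B C : countType) (X : T -> A) (Y : T -> B) (f : A -> B -> C) :
  observable X -> observable Y -> observable (fun w => f (X w) (Y w)).
Proof.
move=> oX oY c.
(* The pairs of values are enumerated, to obtain a union over the naturals. *)
pose F n := if unpickle n is Some (a, b) then
  if f a b == c then [set w | X w = a] `&` [set w | Y w = b] else set0 else set0.
case: (sG) => G0 _ GU.
have -> : [set w | f (X w) (Y w) = c] = \bigcup_n F n.
  rewrite eqEsubset; split=> w /=.
    move=> fc; exists (pickle (X w, Y w)) => //.
    by rewrite /F pickleK fc eqxx.
  move=> [n _]; rewrite /F; case: unpickle => // -[a b].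
  by case: eqP => // <- [/= -> ->].
apply: GU => n; rewrite /F; case: unpickle => // -[a b].
by case: ifP => // _; apply: sigma_algebra_setI; [exact: oX|exact: oY].
Qed.

Lemma observable_cst (A : eqType) (c : A) : observable (fun=> c).
Proof.
case: (sG) => G0 GC _ a; case: (eqVneq c a) => [->|/eqP ca].
  rewrite (_ : [set _ | _] = setT); first by rewrite -(setD0 setT); exact: GC.
  by rewrite eqEsubset; split.
by rewrite (_ : [set _ | _] = set0)// eqEsubset; split.
Qed.

Lemma observable_op1 (A C : countType) (X : T -> A) (f : A -> C) :
  observable X -> observable (fun w => f (X w)).
Proof.
by move=> oX; exact: (observable_op2 (fun a _ => f a) oX (observable_cst tt)).
Qed.

End observables.

Lemma sum_pred1 (R : realType) (b : nat -> bool) (v l : nat) :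
  \sum_(k < l.+1) (b k && (v == k))%:R = ((v <= l)%N && b v)%:R :> R.
Proof.
case: (leqP v l) => vl /=; last first.
  rewrite big1// => i _; case: eqP => [vi|_]; last by rewrite andbF.
  by have := ltn_ord i; rewrite -vi ltnS leqNgt vl.
rewrite (bigD1 (Ordinal (vl : v < l.+1)%N))//= eqxx andbT big1 ?addr0// => i.
by rewrite -(inj_eq val_inj)/= eq_sym => /negbTE ->; rewrite andbF.
Qed.

Section probability_toolkit.
Context d (T : measurableType d) (R : realType) (P : probability T R).

(** Events are boolean functions, so that relations between events become
    pointwise computations. *)
Definition event (b : T -> bool) := observable measurable b.

Lemma measurable_sigma_algebra : sigma_algebra [set: T] (@measurable d T).
Proof.
split; [exact: measurable0| |exact: bigcupT_measurable].
by move=> A mA; rewrite setTD; exact: measurableC.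
Qed.

Lemma event_measurable b : event b -> measurable [set w | b w].
Proof. by move=> /(_ true). Qed.

Definition pr (b : T -> bool) : R := fine (P [set w | b w]).

Lemma prE b : event b -> P [set w | b w] = (pr b)%:E.
Proof.
by move=> /event_measurable mb; rewrite fineK// fin_num_measure.
Qed.

(** Integrability together with the value of the integral: a linear inequality
    between probabilities follows from the inequality between indicators. *)
Definition has_mean (f : T -> R) (m : R) : Prop :=
  P.-integrable [set: T] (fun w => (f w)%:E) /\
  (\int[P]_w (f w)%:E)%E = m%:E.

Lemma has_mean_event b : event b -> has_mean (fun w => (b w)%:R) (pr b).
Proof.
move=> eb; have mb := event_measurable eb.
have E : (fun w => ((b w)%:R : R)%:E) = (fun w => (\1_[set w | b w] w)%:E).
  apply/funext => w; rewrite indicE; congr ((_%:R)%:E).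
  by congr nat_of_bool; apply/idP/idP; rewrite in_setE.
by split; rewrite E; [exact: integrable_indic|rewrite integral_indic// setIT; exact: prE].
Qed.

Lemma has_meanD f g a b : has_mean f a -> has_mean g b ->
  has_mean (fun w => f w + g w) (a + b).
Proof.
move=> [If Ef] [Ig Eg]; split.
  by under eq_fun do rewrite EFinD; exact: integrableD.
by under eq_integral do rewrite EFinD; rewrite integralD// Ef Eg.
Qed.

Lemma has_meanZ f a c : has_mean f a -> has_mean (fun w => c * f w) (c * a).
Proof.
move=> [If Ef]; split.
  by under eq_fun do rewrite EFinM; exact: integrableZl.
by under eq_integral do rewrite EFinM; rewrite integralZl// Ef.
Qed.

Lemma has_mean_sum n (f : nat -> T -> R) (a : nat -> R) :
  (forall i, has_mean (f i) (a i)) ->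
  has_mean (fun w => \sum_(i < n) f i w) (\sum_(i < n) a i).
Proof.
move=> H; elim: n => [|n IH].
  rewrite big_ord0; under eq_fun do rewrite big_ord0.
  by split; [exact: integrable0|exact: integral0].
by rewrite big_ord_recr; under eq_fun do rewrite big_ord_recr; exact: has_meanD.
Qed.

(** The difference agrees almost everywhere with its absolute value. *)
Lemma has_mean_le f g a b : has_mean f a -> has_mean g b ->
  (\forall w \ae P, f w <= g w) -> a <= b.
Proof.
move=> hf hg fg; rewrite -subr_ge0.
have [Ih Eh] : has_mean (fun w => g w + (-1) * f w) (b + (-1) * a).
  by apply: has_meanD => //; exact: has_meanZ.
rewrite -mulN1r -lee_fin -Eh.
have mh := measurable_int P Ih.
have -> : (\int[P]_w (g w + (-1) * f w)%:E = \int[P]_w `|(g w + (-1) * f w)%:E|)%E.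
  apply: ae_eq_integral => //; first exact: measurable_int (integrable_abse Ih).
  apply: filterS fg => w fgw _ /=.
  by rewrite ger0_norm// mulN1r subr_ge0.
exact: integral_ge0.
Qed.

Lemma eq_pr b b' : b =1 b' -> pr b = pr b'.
Proof. by move=> /funext ->. Qed.

Lemma pr_ge0 b : event b -> 0 <= pr b.
Proof. by move=> eb; rewrite -lee_fin -prE. Qed.

Lemma pr_le1 b : event b -> pr b <= 1.
Proof.
by move=> eb; rewrite -lee_fin -prE//; exact/probability_le1/event_measurable.
Qed.

Lemma ae_pr_le b b' : event b -> event b' -> (\forall w \ae P, b w -> b' w) ->
  pr b <= pr b'.
Proof.
move=> eb eb' bb'; apply: has_mean_le (has_mean_event eb) (has_mean_event eb') _.
by apply: filterS bb' => w h; rewrite ler_nat; move: h; case: (b w) => // ->.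
Qed.

Lemma ae_pr_eq b b' : event b -> event b' -> (\forall w \ae P, b w = b' w) ->
  pr b = pr b'.
Proof.
by move=> eb eb' bb'; apply/eqP; rewrite eq_le !ae_pr_le//;
  apply: filterS bb' => w ->.
Qed.

Lemma pr_cst (c : bool) : pr (fun=> c) = c%:R.
Proof.
rewrite /pr; case: c.
  rewrite (_ : [set _ | _] = setT) ?probability_setT//.
  by rewrite eqEsubset; split.
by rewrite (_ : [set _ | _] = set0) ?measure0// eqEsubset; split.
Qed.

Lemma pr_split (b : T -> bool) (X : T -> nat) l :
  event b -> observable measurable X -> (forall w, b w -> (X w <= l)%N) ->
  pr b = \sum_(k < l.+1) pr (fun w => b w && (X w == k)).
Proof.
move=> eb oX bX.
have ek k : event (fun w => b w && (X w == k)).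
  have sG := measurable_sigma_algebra.
  apply: (observable_op2 sG andb) => //.
  exact: (observable_op1 sG (fun x => x == k)).
have hs := has_mean_sum l.+1 (fun k => has_mean_event (ek k)).
have E w : (b w)%:R = \sum_(k < l.+1) (b w && (X w == k))%:R :> R.
  by rewrite (sum_pred1 R (fun=> b w)); case: (boolP (b w)) => [/bX ->//|]; rewrite andbF.
by apply/eqP; rewrite eq_le; apply/andP; split;
  [apply: has_mean_le (has_mean_event eb) hs _|
   apply: has_mean_le hs (has_mean_event eb) _];
  apply: aeW => w; rewrite E.
Qed.

End probability_toolkit.

(** * One cell *)

(** The deterministic content of the balance equation, with H = [layers] at the
    beginning and H' at the end of a cell, and k, k' telling whether layer r + 1
    has a centre particle.  With a single arrival, 1{H' > r} - 1{H > r} is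
    1 exactly when H = r and the arrival is at the centre (jc), or at a side that
    is not behind the other (jl, jm), and k' - k is 1 exactly in the first
    case.  If both sides are level, a jump of either counts, which is the origin
    of the tied term in [balance_step].  The factor 10 covers all cells with more
    arrivals. *)
Lemma layer_balance (l c m l' c' m' r : nat) (k k' : bool) :
  (l <= l')%N -> (c <= c')%N -> (m <= m')%N ->
  (k -> (r < layers l c m)%N) ->
  (l' - l + (c' - c) + (m' - m) <= 1 ->
    k' = k || ((r == layers l c m) && (c < c')))%N ->
  let jc := ((layers l c m == r) && (c < c'))%N in
  let jl := ((layers l c m == r) && (m <= l) && (l < l'))%N in
  let jm := ((layers l c m == r) && (l <= m) && (m < m'))%N in
  let b := (2 <= l' - l + (c' - c) + (m' - m))%N in
  (2 * k' + (r < layers l c m) + jl + jm <=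
     2 * k + (r < layers l' c' m') + jc + 10 * b)%N /\
  (2 * k + (r < layers l' c' m') + jc <=
     2 * k' + (r < layers l c m) + jl + jm + 10 * b)%N.
Proof.
move=> ll cc mm kr kk /=.
case: (leqP 2 (l' - l + (c' - c) + (m' - m))) => b.
  move=> {kr kk}; move: (r < layers l c m)%N (r < layers l' c' m')%N ((_ == r) && (c < c'))%N
    ((_ == r) && _ && (l < l'))%N ((_ == r) && _ && (m < m'))%N k k'.
  by do 7![case].
have {kk} -> := kk b.
have : [\/ [/\ l' = l, c' = c & m' = m], [/\ l' = l.+1, c' = c & m' = m],
  [/\ l' = l, c' = c.+1 & m' = m] | [/\ l' = l, c' = c & m' = m.+1]].
  case: (ltnP l l') => h1; first by constructor 2; split; lia.
  case: (ltnP c c') => h2; first by constructor 3; split; lia.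
  by case: (ltnP m m') => h3; [constructor 4|constructor 1]; split; lia.
rewrite (eq_sym r).
case=> -[-> -> ->] {l' c' m' b ll cc mm}; rewrite !ltnn !(ltnSn, andbF, andbT, orbF).
- by split; lia.
- have -> : layers l.+1 c m = (layers l c m + (m <= l))%N by rewrite /layers; lia.
  move: (layers l c m) kr => h kr.
  by case: (m <= l)%N; case: k kr => [/(_ isT)|_]; rewrite ?andbT ?andbF; lia.
- have -> : layers l c.+1 m = (layers l c m).+1 by [].
  move: (layers l c m) kr => h kr.
  by case: k kr => [/(_ isT)|_]; lia.
- have -> : layers l c m.+1 = (layers l c m + (l <= m))%N by rewrite /layers; lia.
  move: (layers l c m) kr => h kr.
  by case: (l <= m)%N; case: k kr => [/(_ isT)|_]; rewrite ?andbT ?andbF; lia.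
Qed.

(** * Laws of the arrival counts *)

Section parking_process.
Context (R : realType) (d : measure_display) (T : measurableType d)
  (P : probability T R) (N : position -> R -> T -> nat)
  (kappa : R -> T -> config) (PS : parking_system P N kappa).
Implicit Types (s u t : R) (x y : position) (w : T).

Notation L := (N leftpos).
Notation C := (N middle).
Notation M := (N rightpos).
Let sG := measurable_sigma_algebra T.

Definition counts w : position -> R -> nat := fun x t => N x t w.

Definition jump x s u w : bool := (N x s w < N x u w)%N.

Lemma observable_count x s : 0 <= s -> observable measurable (N x s).
Proof.
case: PS => pp _ bd _ _ s0 a.
case: (boolP (x \in active)) => xa.
  have [mN _ _ _] := pp x xa.
  by have := mN s s0 measurableT [set a] I; rewrite setTI.
have -> : N x s = (fun=> 0%N) by apply/funext => w; exact: bd.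
exact: (observable_cst (measurable_sigma_algebra T)).
Qed.

Lemma sigma_of_process_algebra x :
  sigma_algebra [set: T] (sigma_of_process (N x)).
Proof. exact: smallest_sigma_algebra. Qed.

Lemma observable_process x s : 0 <= s ->
  observable (sigma_of_process (N x)) (N x s).
Proof.
move=> s0 a; apply: sub_sigma_algebra; exists s => //.
by exists [set a] => //; rewrite setTI.
Qed.

Lemma event_process x (b : T -> bool) :
  observable (sigma_of_process (N x)) b -> event b.
Proof.
move=> ob c; apply: (smallest_sub _ _ (ob c)).
  exact: measurable_sigma_algebra.
move=> _ [s s0 [B _ <-]]; rewrite setTI.
have -> : N x s @^-1` B = [set w | (N x s w \in B) = true].
  by rewrite eqEsubset; split=> w /=; [exact: mem_set|exact: set_mem].
exact: (observable_op1 (measurable_sigma_algebra T) (fun k => k \in B)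
  (observable_count x s0)).
Qed.

Lemma pr_independent (bl bm br : T -> bool) :
  observable (sigma_of_process (N leftpos)) bl ->
  observable (sigma_of_process (N middle)) bm ->
  observable (sigma_of_process (N rightpos)) br ->
  pr P (fun w => [&& bl w, bm w & br w]) = pr P bl * pr P bm * pr P br.
Proof.
move=> ol om or; case: PS => _ ind _ _ _.
pose A x := if x == leftpos then [set w | bl w] else
  if x == middle then [set w | bm w] else [set w | br w].
have := ind active A (subxx _).
have -> : \bigcap_(i in [set` active]) A i = [set w | [&& bl w, bm w & br w]].
  rewrite eqEsubset; split=> w /=.
    by move=> h; apply/and3P; split; [exact: (h leftpos active_left)|
      exact: (h middle active_middle)|exact: (h rightpos active_right)].
  move=> /and3P[hl hm hr] x /activeE; rewrite !inE => /or3P[] /eqP->//.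
have -> : (\prod_(i in active) P (A i) = (pr P bl * pr P bm * pr P br)%:E)%E.
  rewrite big_mkcond /= !big_ord_recl big_ord0.
  have e1 : lift (@ord0 4) ord0 = leftpos by exact/val_inj.
  have e2 : lift (@ord0 4) (lift ord0 ord0) = middle by exact/val_inj.
  have e3 : lift (@ord0 4) (lift ord0 (lift ord0 ord0)) = rightpos by exact/val_inj.
  rewrite e1 e2 e3 active_left active_middle active_right !inE /A /=.
  rewrite (prE P (event_process ol)) (prE P (event_process om)) (prE P (event_process or)).
  by rewrite !mul1e !mule1 -!EFinM mulrA.
move=> h; apply: EFin_inj; rewrite -h; last first.
  by move=> x /activeE; rewrite !inE => /or3P[] /eqP->; [exact: ol|exact: om|exact: or].
rewrite prE//.
apply: (observable_op2 sG andb); first exact: event_process ol.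
by apply: (observable_op2 sG andb); [exact: event_process om|exact: event_process or].
Qed.

Lemma pr_increment x s u k : x \in active -> 0 <= s -> s < u ->
  pr P (fun w => increment (counts w) s u x == k) = poisson_pmf (u - s) k.
Proof.
case: PS => pp _ _ _ _ xa s0 su; have [_ _ inc _] := pp x xa.
rewrite /pr (_ : [set w | _] = [set w | (N x u w - N x s w)%N = k]).
  by rewrite inc// mul1r.
by rewrite eqEsubset; split=> w /= /eqP.
Qed.

Lemma ae_counting x : x \in active -> \forall w \ae P, counting_path (counts w x).
Proof. by case: PS => pp _ _ _ _ /pp[]. Qed.

Lemma ae_good_path : \forall w \ae P, good_path (counts w) (kappa ^~ w).
Proof.
case: (PS) => _ _ bd _ pk.
have hl := ae_counting active_left; have hm := ae_counting active_middle.
have hr := ae_counting active_right.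
near=> w; split; first by near: w.
  move=> x /activeE; rewrite !inE => /or3P[] /eqP->; near: w; assumption.
by move=> x t xa t0; exact: bd.
Unshelve. all: by end_near. Qed.

Lemma ae_count0 x : x \in active -> \forall w \ae P, N x 0 w = 0%N.
Proof. by move=> /ae_counting; apply: filterS => w []. Qed.

(** N x 0 vanishes only almost surely, so the count at s and the increment from 0 to
    s are equal only almost surely. *)
Lemma pr_count x s k : x \in active -> 0 < s ->
  pr P (fun w => N x s w == k) = poisson_pmf s k.
Proof.
move=> xa s0; rewrite -[s in RHS]subr0 -(pr_increment k xa (lexx 0) s0).
apply: ae_pr_eq.
- exact: (observable_op1 sG (eq_op^~ k) (observable_count x (ltW s0))).
- exact: (observable_op2 sG (fun a b => a - b == k)%N
    (observable_count x (ltW s0)) (observable_count x (lexx 0))).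
- by apply: filterS (ae_count0 xa) => w; rewrite /increment /counts => ->; rewrite subn0.
Qed.

Lemma event_jump x s u : 0 <= s -> s < u -> event (jump x s u).
Proof.
move=> s0 su; have u0 := ltW (le_lt_trans s0 su).
exact: (observable_op2 (measurable_sigma_algebra T) ltn (observable_count x s0)
  (observable_count x u0)).
Qed.

Lemma pr_not b : event b -> pr P (fun w => ~~ b w) = 1 - pr P b.
Proof.
move=> eb; apply: EFin_inj; rewrite EFinB -!prE//.
  rewrite -probability_setC; last exact: event_measurable.
  by congr (P _); rewrite eqEsubset; split=> w /=; move/negP.
exact: (observable_op1 (measurable_sigma_algebra T) negb).
Qed.

Definition jump_prob (h : R) : R := 1 - expR (- h).

Lemma pr_jump x s u : x \in active -> 0 <= s -> s < u ->
  pr P (jump x s u) = jump_prob (u - s).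
Proof.
move=> xa s0 su; have u0 := ltW (le_lt_trans s0 su).
rewrite (eq_pr P (b' := fun w => ~~ (increment (counts w) s u x == 0%N))); last first.
  by move=> w; rewrite /increment /counts /jump subn_eq0 -ltnNge.
rewrite pr_not.
  by rewrite pr_increment// /poisson_pmf subr_gt0 su expr0 fact0 invr1 !mul1r.
exact: (observable_op2 (measurable_sigma_algebra T) (fun a b => a - b == 0)%N
  (observable_count x u0) (observable_count x s0)).
Qed.

(** Independence of the increments over the two intervals from 0 to s and from s
    to u. *)
Lemma pr_count_jump x s u a : x \in active -> 0 <= s -> s < u ->
  pr P (fun w => (N x s w == a) && jump x s u w) =
  pr P (fun w => N x s w == a) * jump_prob (u - s).
Proof.
move=> xa s0 su; have u0 := ltW (le_lt_trans s0 su).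
rewrite -(pr_jump xa s0 su).
case: (PS) => pp _ _ _ _; have [_ _ _ ind] := pp x xa.
have obs := @observable_count x.
(* The times 0, s, u delimit the two increments. *)
pose tt (i : nat) : R := if i is i'.+1 then if i' is 0 then s else u else 0.
pose A (i : 'I_2) := if i == ord0 then [set w | (N x s w - N x 0 w)%N = a]
  else [set w | (0 < N x u w - N x s w)%N].
have := ind 2%N tt (lexx 0) _ [set: 'I_2]%SET A (subxx _) _.
have -> : \bigcap_(i in [set` [set: 'I_2]%SET]) A i =
    [set w | (N x s w - N x 0 w == a)%N && jump x s u w].
  rewrite eqEsubset; split=> w /=.
    move=> h; apply/andP; split.
      by apply/eqP; apply: (h ord0); rewrite /= inE.
    have := h (lift ord0 ord0); rewrite /= inE => /(_ isT).
    by rewrite /A /= subn_gt0.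
  move=> /andP[/eqP e1 e2] i _; rewrite /A; case: ifP => // _ /=.
  by rewrite subn_gt0.
rewrite (eq_bigl predT); last by move=> i; rewrite inE.
rewrite !big_ord_recl big_ord0 mule1.
have -> : P (A ord0) = (pr P (fun w => (N x s w - N x 0 w)%N == a))%:E.
  rewrite -prE; last exact: (observable_op2 sG (fun a' b => a' - b == a)%N
    (obs s s0) (obs 0 (lexx 0))).
  by congr (P _); rewrite eqEsubset; split=> w /= /eqP.
have -> : P (A (lift ord0 ord0)) = (pr P (jump x s u))%:E.
  rewrite -prE; last exact: event_jump.
  by congr (P _); rewrite eqEsubset; split=> w; rewrite /A /= subn_gt0.
rewrite prE; last exact: (observable_op2 sG andb (observable_op2 sG
    (fun a' b => a' - b == a)%N (obs s s0) (obs 0 (lexx 0))) (event_jump x s0 su)).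
have z := ae_count0 xa.
have E (b : T -> bool) : event b ->
    pr P (fun w => (N x s w - N x 0 w == a)%N && b w) =
    pr P (fun w => (N x s w == a) && b w).
  move=> eb; apply: ae_pr_eq.
  - exact: (observable_op2 sG andb (observable_op2 sG
      (fun a' b => a' - b == a)%N (obs s s0) (obs 0 (lexx 0))) eb).
  - exact: (observable_op2 sG andb
      (observable_op1 sG (eq_op^~ a) (obs s s0)) eb).
  - by apply: filterS z => w ->; rewrite subn0.
have -> : pr P (fun w => N x s w - N x 0 w == a)%N = pr P (fun w => N x s w == a).
  have := E _ (observable_cst sG true).
  rewrite (eq_pr P (b' := fun w => N x s w - N x 0 w == a)%N); last first.
    by move=> w; rewrite andbT.
  by move=> ->; apply: eq_pr => w; rewrite andbT.
rewrite E; last exact: event_jump.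
move=> h; apply: EFin_inj; rewrite EFinM; apply: h.
- by move=> [|[|]]//= _; exact: ltW.
- move=> i _; rewrite /A; case: ifPn => i0.
    exists [set a] => //; rewrite setTI /=.
    by move/eqP: i0 => ->.
  exists [set k | (0 < k)%N] => //; rewrite setTI /=.
  suff -> : i = lift ord0 ord0 by [].
  by apply/val_inj; case: i i0 => -[|[|]].
Qed.

Lemma process_count x s a : 0 <= s ->
  observable (sigma_of_process (N x)) (fun w => N x s w == a).
Proof.
move=> s0; exact: (observable_op1 (sigma_of_process_algebra x) (eq_op^~ a)
  (@observable_process x _ s0)).
Qed.

Lemma process_jump x s u : 0 <= s -> s < u ->
  observable (sigma_of_process (N x)) (jump x s u).
Proof.
move=> s0 su; have u0 := ltW (le_lt_trans s0 su).
exact: (observable_op2 (sigma_of_process_algebra x) ltn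
  (@observable_process x _ s0) (@observable_process x _ u0)).
Qed.

Lemma process_and x (b b' : T -> bool) :
  observable (sigma_of_process (N x)) b ->
  observable (sigma_of_process (N x)) b' ->
  observable (sigma_of_process (N x)) (fun w => b w && b' w).
Proof. exact: (observable_op2 (sigma_of_process_algebra x) andb). Qed.

Lemma process_true x : observable (sigma_of_process (N x)) (fun=> true).
Proof. exact: (observable_cst (sigma_of_process_algebra x)). Qed.

Lemma event_and (b b' : T -> bool) :
  event b -> event b' -> event (fun w => b w && b' w).
Proof. exact: (observable_op2 sG andb). Qed.

Lemma event_counts (p : nat -> nat -> nat -> bool) s : 0 <= s ->
  event (fun w => p (L s w) (C s w) (M s w)).
Proof.
move=> s0; apply: (observable_op2 sG (fun (z : nat * nat) m => p z.1 z.2 m)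
  (X := fun w => (L s w, C s w))); last exact: observable_count.
exact: (observable_op2 sG pair (observable_count _ s0) (observable_count _ s0)).
Qed.

Lemma pr_counts_jump x s u a c m : x \in active -> 0 <= s -> s < u ->
  pr P (fun w => [&& L s w == a, C s w == c & M s w == m] && jump x s u w) =
  jump_prob (u - s) * pr P (fun w => [&& L s w == a, C s w == c & M s w == m]).
Proof.
move=> xa s0 su.
have pc y k := @process_count y s k s0.
have pj y := @process_jump y s u s0 su.
have pcj y k := process_and (pc y k) (pj y).
rewrite (pr_independent (pc _ a) (pc _ c) (pc _ m)).
have := activeE xa; rewrite !inE => /or3P[] /eqP-> {x xa}.
- rewrite (eq_pr P (b' := fun w => [&& (L s w == a) && jump leftpos s u w,
      C s w == c & M s w == m])); last by move=> w; rewrite !andbA; do !case: (_ == _); rewrite ?andbT ?andbF.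
  rewrite (pr_independent (pcj _ a) (pc _ c) (pc _ m)) (pr_count_jump)//.
  by ring.
- rewrite (eq_pr P (b' := fun w => [&& L s w == a,
      (C s w == c) && jump middle s u w & M s w == m])); last by move=> w; do !case: (_ == _); rewrite ?andbT ?andbF.
  rewrite (pr_independent (pc _ a) (pcj _ c) (pc _ m)) (pr_count_jump)//.
  by ring.
- rewrite (eq_pr P (b' := fun w => [&& L s w == a, C s w == c &
      (M s w == m) && jump rightpos s u w])); last by move=> w; do !case: (_ == _); rewrite ?andbT ?andbF.
  rewrite (pr_independent (pc _ a) (pc _ c) (pcj _ m)) (pr_count_jump)//.
  by ring.
Qed.

Lemma pr_split_counts (b : T -> bool) s l : event b -> 0 <= s ->
  (forall w, b w -> [&& L s w <= l, C s w <= l & M s w <= l]%N) ->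
  pr P b = \sum_(a < l.+1) \sum_(c < l.+1) \sum_(m < l.+1)
    pr P (fun w => [&& L s w == a, C s w == c & M s w == m] && b w).
Proof.
move=> eb s0 bl; have obs x := observable_count x s0.
have ec x k : event (fun w => N x s w == k).
  exact: (observable_op1 sG (eq_op^~ k) (obs x)).
rewrite (pr_split P (l := l) eb (obs leftpos)); last by move=> w /bl /and3P[].
apply: eq_bigr => a _.
have ea := event_and eb (ec leftpos a).
rewrite (pr_split P (l := l) ea (obs middle)); last by move=> w /andP[/bl /and3P[]].
apply: eq_bigr => c _.
rewrite (pr_split P (l := l) (event_and ea (ec middle c)) (obs rightpos)); last first.
  by move=> w /andP[/andP[/bl /and3P[]]].
apply: eq_bigr => m _; apply: eq_pr => w.
by rewrite !andbA [RHS]andbC !andbA.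
Qed.

(** The past enters only through the three counts at time s.  The bound l makes the
    decomposition over their values a finite sum. *)
Lemma pr_jump_independent (p : nat -> nat -> nat -> bool) l x s u :
  x \in active -> 0 <= s -> s < u ->
  (forall a c m, p a c m -> [&& a <= l, c <= l & m <= l]%N) ->
  pr P (fun w => p (L s w) (C s w) (M s w) && jump x s u w) =
  jump_prob (u - s) * pr P (fun w => p (L s w) (C s w) (M s w)).
Proof.
move=> xa s0 su pl.
have ep := event_counts p s0.
rewrite (pr_split_counts (l := l) (event_and ep (event_jump x s0 su)) s0); last first.
  by move=> w /andP[/pl].
rewrite (pr_split_counts (l := l) ep s0); last by move=> w /pl.
rewrite mulr_sumr; apply: eq_bigr => a _.
rewrite mulr_sumr; apply: eq_bigr => c _.
rewrite mulr_sumr; apply: eq_bigr => m _.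
have E (b : T -> bool) :
    pr P (fun w => [&& L s w == a, C s w == c & M s w == m] &&
      (p (L s w) (C s w) (M s w) && b w)) =
    if p a c m then pr P (fun w => [&& L s w == a, C s w == c & M s w == m] && b w)
    else 0.
  have -> : 0 = pr P (fun=> false) :> R by rewrite pr_cst.
  case: ifP => pacm; apply: eq_pr => w;
    by case: eqP => //= ->; case: eqP => //= ->; case: eqP => //= ->; rewrite pacm.
rewrite E.
have := E (fun=> true); rewrite (eq_pr P (b' := fun w =>
  [&& L s w == a, C s w == c & M s w == m] && p (L s w) (C s w) (M s w))); last first.
  by move=> w; rewrite andbT.
move=> ->; case: ifP => _; last by rewrite mulr0.
rewrite pr_counts_jump//; congr (_ * _); apply: eq_pr => w; by rewrite andbT.
Qed.

Lemma jump_prob_ge0 h : 0 <= h -> 0 <= jump_prob h :> R.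
Proof. by move=> h0; rewrite subr_ge0 -expR0 ler_expR oppr_le0. Qed.

Lemma jump_prob_le h : jump_prob h <= h :> R.
Proof. by have := expR_ge1Dx (- h); rewrite /jump_prob; lra. Qed.

Lemma event_increment x s u (p : pred nat) : 0 <= s -> s < u ->
  event (fun w => p (increment (counts w) s u x)).
Proof.
move=> s0 su; have u0 := ltW (le_lt_trans s0 su).
exact: (observable_op2 sG (fun a b => p (a - b)%N) (observable_count x u0)
  (observable_count x s0)).
Qed.

(** The probability is 1 - (1 + h) exp(-h) with h = u - s, and exp(-h) >= 1 - h. *)
Lemma pr_two_increments x s u : x \in active -> 0 <= s -> s < u ->
  pr P (fun w => 2 <= increment (counts w) s u x)%N <= (u - s) ^+ 2.
Proof.
move=> xa s0 su.
have h0 : 0 < u - s by rewrite subr_gt0.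
have ei p := event_increment x p s0 su.
have H := has_meanD (has_meanD (has_mean_event P (ei (eq_op^~ 0%N)))
  (has_mean_event P (ei (eq_op^~ 1%N)))) (has_mean_event P (ei (leq 2))).
have := has_mean_le H (has_mean_event P (observable_cst sG true)) _.
rewrite !(pr_increment)// pr_cst /poisson_pmf h0 expr0 expr1 fact0 invr1 !mul1r mulr1.
set e := expR _ => /(_ _)/wrap[].
  by apply: aeW => w; case: increment => [|[|]] //=; rewrite ?addr0 ?add0r.
have : 1 - (u - s) <= e by apply: expR_ge1Dx.
rewrite -subr_ge0 => e1.
have := mulr_ge0 (addr_ge0 ler01 (ltW h0)) e1.
rewrite expr2 /=; lra.
Qed.

Lemma event_arrivals s u (p : pred nat) : 0 <= s -> s < u ->
  event (fun w => p (arrivals (counts w) s u)).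
Proof.
move=> s0 su; have u0 := ltW (le_lt_trans s0 su).
have oi x : observable measurable (fun w => increment (counts w) s u x).
  exact: (observable_op2 sG subn (observable_count x u0)
  (observable_count x s0)).
apply: (observable_op2 sG (fun a b => p (a + b)%N) _ (oi rightpos)).
exact: (observable_op2 sG addn (oi leftpos) (oi middle)).
Qed.

(** Either some position receives two particles, or two positions receive one
    each: three cases of each kind, each of probability at most (u - s)^2. *)
Lemma pr_two_arrivals s u : 0 <= s -> s < u ->
  pr P (fun w => 2 <= arrivals (counts w) s u)%N <= 6 * (u - s) ^+ 2.
Proof.
move=> s0 su; have h0 : 0 < u - s by rewrite subr_gt0.
have ei x := event_increment x (leq 2) s0 su.
have pj x := @process_jump x s u s0 su.
have pt x := @process_true x.
have q2 : jump_prob (u - s) * jump_prob (u - s) <= (u - s) ^+ 2.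
  by rewrite expr2 ler_pM ?jump_prob_ge0 ?jump_prob_le// ltW.
have lm := pr_independent (pj leftpos) (pj middle) (pt rightpos).
have lr := pr_independent (pj leftpos) (pt middle) (pj rightpos).
have mr := pr_independent (pt leftpos) (pj middle) (pj rightpos).
rewrite !(pr_jump)// ?pr_cst ?mulr1 ?mul1r in lm lr mr.
have ej x := event_jump x s0 su.
have et : event (fun _ : T => true) by exact: observable_cst.
have hl := has_mean_event P (event_and (ej leftpos) (event_and (ej middle) et)).
have hm := has_mean_event P (event_and (ej leftpos) (event_and et (ej rightpos))).
have hr := has_mean_event P (event_and et (event_and (ej middle) (ej rightpos))).
rewrite lm in hl; rewrite lr in hm; rewrite mr in hr.
have H := has_meanD (has_meanD (has_meanD (has_mean_event P (ei leftpos))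
  (has_mean_event P (ei middle))) (has_mean_event P (ei rightpos)))
  (has_meanD (has_meanD hl hm) hr).
apply: le_trans (has_mean_le (has_mean_event P (event_arrivals (leq 2) s0 su)) H _) _.
  apply: aeW => w; rewrite -!natrD ler_nat /arrivals.
  have jE x : jump x s u w = (0 < increment (counts w) s u x)%N.
    by rewrite /jump -subn_gt0.
  rewrite !jE; by do 3![case: (increment _ _ _ _) => [|[|?]]].
have := pr_two_increments active_left s0 su.
have := pr_two_increments active_middle s0 su.
have := pr_two_increments active_right s0 su; lra.
Qed.

(** * The balance of centre and side layers *)

(** The grid of n cells on the interval from 0 to s fails to separate the arrivals
    with probability at most 6 s^2 / n, so almost surely some grid separates
    them. *)
Lemma ae_stacked s : 0 <= s -> \forall w \ae P, stacked_at (counts w) (kappa ^~ w) s.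
Proof.
rewrite le_eqVlt => /predU1P[<-|s0].
  apply: filterS ae_good_path => w G.
  by apply: (stacked_grid G (lexx 0) (ltn0Sn 0)) => i _; rewrite !mul0r /arrivals /increment !subnn.
pose b m i w := (2 <= arrivals (counts w) (s * i%:R / m.+1%:R) (s * i.+1%:R / m.+1%:R))%N.
pose B m := \big[setU/set0]_(i < m.+1) [set w | b m i w].
have m0 m : 0 < m.+1%:R :> R by rewrite ltr0n.
have g0 m i : 0 <= s * i%:R / m.+1%:R by rewrite divr_ge0// mulr_ge0// ltW.
have gS m i : s * i%:R / m.+1%:R < s * i.+1%:R / m.+1%:R.
  by rewrite ltr_pM2r ?invr_gt0// ltr_pM2l// ltr_nat.
have eb m i : event (b m i) by exact: (event_arrivals (leq 2)).
have mB m : measurable (B m).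
  by rewrite /B; apply: bigsetU_measurable => i _; exact: event_measurable (eb m i).
have PB m : (P (B m) <= (6 * s ^+ 2 / m.+1%:R)%:E)%E.
  apply: (le_trans (@Boole_inequality _ _ _ P (fun i => [set w | b m i w]) m.+1 _)).
    by move=> i _; exact: event_measurable (eb m i).
  apply: (@le_trans _ _ (\sum_(i < m.+1) (6 * (s / m.+1%:R) ^+ 2)%:E)%E).
    apply: lee_sum => i _; rewrite -[X in (X <= _)%E]/(P [set w | b m i w]) (prE P (eb m i)) lee_fin.
    apply: le_trans (pr_two_arrivals (g0 m i) (gS m i)) _.
    by rewrite -mulrBl -mulrBr -natrB// subSnn mulr1.
  rewrite sumEFin lee_fin sumr_const card_ord -mulr_natl le_eqVlt.
  by apply/orP; left; apply/eqP; field; rewrite gt_eqF.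
have PB0 : P (\bigcap_m B m) = 0.
  apply/eqP; rewrite eq_le measure_ge0 andbT; apply/lee_addgt0Pr => e e0.
  rewrite add0e.
  (* A grid fine enough for a failure probability below e. *)
  pose m := Num.truncn (6 * s ^+ 2 / e).
  apply: (@le_trans _ _ (P (B m))).
    apply: le_measure; rewrite ?inE//; first exact: bigcap_measurable.
    by move=> w; apply.
  apply: le_trans (PB m) _; rewrite lee_fin ler_pdivrMr// -ler_pdivrMl// mulrC.
  by apply: ltW; exact: truncnS_gt.
have nB : \forall w \ae P, ~ (\bigcap_m B m) w.
  exists (\bigcap_m B m); split=> //; first exact: bigcap_measurable.
  by move=> w /= /contrapT.
apply: filterS2 nB ae_good_path => w nBw G.
have [m nBm] : exists m, ~ B m w by apply/existsNP => h; apply: nBw => m _; exact: h.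
apply: (stacked_grid G (ltW s0) (ltn0Sn m)) => i im.
rewrite leqNgt; apply/negP => bi; apply: nBm.
by rewrite /B -(bigcup_mkord m.+1 (fun i => [set w | b m i w])); exists i.
Qed.

Lemma ae_mono s u : 0 <= s -> s < u ->
  \forall w \ae P, [/\ L s w <= L u w, C s w <= C u w & M s w <= M u w]%N.
Proof.
move=> s0 su; apply: filterS ae_good_path => w [_ cnt _].
have m x : x \in active -> (N x s w <= N x u w)%N.
  by move=> /cnt[_ mono _]; apply: mono => //; exact: ltW.
by split; exact: m.
Qed.

Definition top_layer s w : nat := height (counts w) s.

(** The layer in question is r + 1, so that r is the number of layers present when
    it is opened. *)
Definition center_filled r s w : bool := kappa s w middle r.+1.

Lemma event_center_filled r s : 0 <= s -> event (center_filled r s).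
Proof.
move=> s0; case: PS => _ _ _ mk _ c.
by have := mk s middle r.+1 s0 measurableT [set c] I; rewrite setTI.
Qed.

Lemma event_top_layer (p : pred nat) s : 0 <= s -> event (fun w => p (top_layer s w)).
Proof. by move=> s0; exact: (event_counts (fun l c m => p (layers l c m)) s0). Qed.

Lemma ae_center_filled_step r s u : 0 <= s -> s < u -> \forall w \ae P,
  (center_filled r s w -> (r < top_layer s w)%N) /\
  ((arrivals (counts w) s u <= 1)%N ->
    center_filled r u w = center_filled r s w || ((r == top_layer s w) && (C s w < C u w)%N)).
Proof.
move=> s0 su; apply: filterS2 (ae_stacked s0) ae_good_path => w S G; split.
  move=> f; have := stacked_occupied S r.+1.
  by rewrite [kappa s w middle r.+1]f orbT => /esym.
move=> a; have [_ /(_ r.+1) h] := stacked_step G s0 su a S.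
by move: h; rewrite eqSS.
Qed.

Lemma pr_center_filled_step r s u : 0 <= s -> s < u ->
  pr P (center_filled r s) <= pr P (center_filled r u) + 6 * (u - s) ^+ 2.
Proof.
move=> s0 su; have u0 := ltW (le_lt_trans s0 su).
apply: le_trans (_ : _ <= _ + pr P (fun w => 2 <= arrivals (counts w) s u)%N) _.
  apply: has_mean_le (has_mean_event P (event_center_filled r s0)) (has_meanD
    (has_mean_event P (event_center_filled r u0)) (has_mean_event P (event_arrivals (leq 2) s0 su))) _.
  apply: filterS (ae_center_filled_step r s0 su) => w [_ h].
  rewrite -natrD ler_nat; move: h; case: (leqP 2 (arrivals _ _ _)) => [_ _|a /(_ a) ->].
    by rewrite addn1; case: (center_filled r s w).
  by case: (center_filled r s w).
by rewrite lerD2l; exact: pr_two_arrivals.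
Qed.

(** Twice the density minus the probability that layer r + 1 is occupied at
    all; for s to infinity the latter tends to 1. *)
Definition balance r s : R :=
  2 * pr P (center_filled r s) - pr P (fun w => r < top_layer s w)%N.

Definition tied r s w : bool := (top_layer s w == r) && (L s w == M s w).

(** Let h, hl, hm, h0 be the probabilities of H = r, alone or together with M <= L,
    L <= M, L = M at time s, and q the probability of a jump.  Up to cells with
    two arrivals the increment is 2 q h - (q h + q hl + q hm), and
    hl + hm = h + h0. *)
Lemma balance_step r s u : 0 <= s -> s < u ->
  `|balance r u - balance r s +
     pr P (fun w => tied r s w && jump middle s u w)| <= 60 * (u - s) ^+ 2.
Proof.
move=> s0 su; have u0 := ltW (le_lt_trans s0 su).
pose h := pr P (fun w => top_layer s w == r).
pose hl := pr P (fun w => (top_layer s w == r) && (M s w <= L s w)%N).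
pose hm := pr P (fun w => (top_layer s w == r) && (L s w <= M s w)%N).
pose h0 := pr P (tied r s).
have ec p : event (fun w => p (L s w) (C s w) (M s w)) := event_counts p s0.
have el : event (fun w => (top_layer s w == r) && (M s w <= L s w)%N).
  exact: (ec (fun l c m => (layers l c m == r) && (m <= l)%N)).
have em : event (fun w => (top_layer s w == r) && (L s w <= M s w)%N).
  exact: (ec (fun l c m => (layers l c m == r) && (l <= m)%N)).
have et : event (tied r s).
  exact: (ec (fun l c m => (layers l c m == r) && (l == m))).
have eh : event (fun w => top_layer s w == r) := event_top_layer (eq_op^~ r) s0.
have hE : hl + hm = h + h0.
  apply/eqP; rewrite eq_le.
  have H1 := has_meanD (has_mean_event P el) (has_mean_event P em).
  have H2 := has_meanD (has_mean_event P eh) (has_mean_event P et).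
  have E w : (((top_layer s w == r) && (M s w <= L s w)%N)%:R +
    ((top_layer s w == r) && (L s w <= M s w)%N)%:R : R) =
    (top_layer s w == r)%:R + (tied r s w)%:R.
    by rewrite -!natrD; congr _%:R; rewrite /tied; case: (top_layer s w == r); case: ltngtP.
  by apply/andP; split; [apply: has_mean_le H1 H2 _|apply: has_mean_le H2 H1 _];
    apply: aeW => w; rewrite E.
have b0 a c m : layers a c m = r -> [&& a <= r, c <= r & m <= r]%N.
  by rewrite /layers => <-; apply/and3P; split; lia.
set q := jump_prob (u - s).
have jc : pr P (fun w => (top_layer s w == r) && jump middle s u w) = q * h.
  apply: (pr_jump_independent (p := fun l c m => layers l c m == r) (l := r)) => //.
  by move=> a c m /eqP /b0.
have jl : pr P (fun w => ((top_layer s w == r) && (M s w <= L s w)%N) && jump leftpos s u w) = q * hl.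
  apply: (pr_jump_independent (p := fun l c m => (layers l c m == r) && (m <= l)%N) (l := r)) => //.
  by move=> a c m /andP[/eqP /b0].
have jm : pr P (fun w => ((top_layer s w == r) && (L s w <= M s w)%N) && jump rightpos s u w) = q * hm.
  apply: (pr_jump_independent (p := fun l c m => (layers l c m == r) && (l <= m)%N) (l := r)) => //.
  by move=> a c m /andP[/eqP /b0].
have jt : pr P (fun w => tied r s w && jump middle s u w) = q * h0.
  apply: (pr_jump_independent (p := fun l c m => (layers l c m == r) && (l == m)) (l := r)) => //.
  by move=> a c m /andP[/eqP /b0].
have ej x := event_jump x s0 su.
have Hf := has_mean_event P (event_center_filled r s0).
have Hf' := has_mean_event P (event_center_filled r u0).
have Ht := has_mean_event P (event_top_layer (leq r.+1) s0).
have Ht' := has_mean_event P (event_top_layer (leq r.+1) u0).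
have Hc := has_mean_event P (event_and eh (ej middle)).
have Hl := has_mean_event P (event_and el (ej leftpos)).
have Hm := has_mean_event P (event_and em (ej rightpos)).
have Hb := has_mean_event P (event_arrivals (leq 2) s0 su).
rewrite jc in Hc; rewrite jl in Hl; rewrite jm in Hm.
pose now w : R := 2 * (center_filled r s w)%:R.
pose later w : R := 2 * (center_filled r u w)%:R.
pose jc_ w : R := ((top_layer s w == r) && jump middle s u w)%:R.
pose jl_ w : R := ((top_layer s w == r) && (M s w <= L s w)%N &&
  jump leftpos s u w)%:R.
pose jm_ w : R := ((top_layer s w == r) && (L s w <= M s w)%N &&
  jump rightpos s u w)%:R.
pose bad_ w : R := 10 * (2 <= arrivals (counts w) s u)%N%:R.
have key : \forall w \ae P,
   later w + (r < top_layer s w)%:R + jl_ w + jm_ w <=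
     now w + (r < top_layer u w)%:R + jc_ w + bad_ w /\
   now w + (r < top_layer u w)%:R + jc_ w <=
     later w + (r < top_layer s w)%:R + jl_ w + jm_ w + bad_ w.
  apply: filterS2 (ae_center_filled_step r s0 su) (ae_mono s0 su) => w [f1 f2] [ll cc mm].
  rewrite /now /later /jc_ /jl_ /jm_ /bad_ -!natrM -!natrD !ler_nat.
  exact: (layer_balance ll cc mm f1 f2).
have I1 := has_mean_le (has_meanD (has_meanD (has_meanD (has_meanZ 2 Hf') Ht) Hl) Hm)
  (has_meanD (has_meanD (has_meanD (has_meanZ 2 Hf) Ht') Hc) (has_meanZ 10 Hb))
  (filterS (fun w => @proj1 _ _) key).
have I2 := has_mean_le (has_meanD (has_meanD (has_meanZ 2 Hf) Ht') Hc)
  (has_meanD (has_meanD (has_meanD (has_meanD (has_meanZ 2 Hf') Ht) Hl) Hm) (has_meanZ 10 Hb))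
  (filterS (fun w => @proj2 _ _) key).
have {}I1 := I1 (ae_filter_ringOfSetsType P).
have {}I2 := I2 (ae_filter_ringOfSetsType P).
have bad := pr_two_arrivals s0 su.
have e : q * hl + q * hm = q * h + q * h0 by rewrite -!mulrDr hE.
rewrite jt /balance ler_norml; apply/andP; split; lra.
Qed.

Lemma event_tied r s : 0 <= s -> event (tied r s).
Proof.
move=> s0.
exact: (event_counts (fun l c m => (layers l c m == r) && (l == m)) s0).
Qed.

(** A nondecreasing function of the time with values between 0 and 1: its
    increments control the loss in [balance_step]. *)
Definition exceed r s : R := pr P (fun w => r < C s w + M s w)%N.

Lemma event_exceed r s : 0 <= s -> event (fun w => r < C s w + M s w)%N.
Proof. by move=> s0; exact: (event_counts (fun l c m => r < c + m)%N s0). Qed.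

(** On the event on the left, L = M = k and C = r - k for some k.  Replacing the
    independent factor P(L = k) by eps leaves the probability that C + M = r and C
    jumps, after which C + M exceeds r. *)
Lemma tied_jump_bound r s u eps : 0 < s -> s < u -> 0 <= eps ->
  (forall m, poisson_pmf s m <= eps) ->
  pr P (fun w => tied r s w && jump middle s u w) <=
  eps * (exceed r u - exceed r s).
Proof.
move=> s0' su e0 small; have s0 := ltW s0'; have u0 := ltW (lt_trans s0' su).
have ej := event_jump middle s0 su.
have eb := event_and (event_tied r s0) ej.
rewrite (pr_split P (l := r) eb (observable_count rightpos s0)); last first.
  by move=> w /andP[/andP[/eqP <- _] _]; rewrite /top_layer /height /counts /layers; lia.
have pc x k := @process_count x _ k s0.
have pj := @process_jump middle _ _ s0 su.
have pt := @process_true leftpos.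
(* The process at -1 contributes the trivial event, in place of L = k. *)
pose G k w := [&& true, (C s w == r - k)%N && jump middle s u w & M s w == k].
have eC k := event_process (pc middle k).
have eG k : event (G k).
  exact: (event_and (observable_cst sG true) (event_and
    (event_and (eC (r - k)%N) ej) (event_process (pc rightpos k)))).
apply: (@le_trans _ _ (\sum_(k < r.+1) eps * pr P (G k))).
  apply: ler_sum => k _; rewrite /G.
  rewrite (pr_independent pt (process_and (pc _ _) pj) (pc _ _)) pr_cst mul1r.
  apply: (@le_trans _ _ (pr P (fun w => [&& L s w == k,
      (C s w == r - k)%N && jump middle s u w & M s w == k]))).
    apply: ae_pr_le.
    - exact: event_and eb (event_process (pc rightpos k)).
    - exact: (event_and (event_process (pc leftpos k)) (event_and
        (event_and (eC (r - k)%N) ej) (event_process (pc rightpos k)))).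
    apply: aeW => w /andP[/andP[/andP[/eqP tr /eqP lm] ->] /eqP mk].
    rewrite lm mk eqxx !andbT /=; move: tr.
    by rewrite /top_layer /height /counts /layers lm mk maxnn => tr; apply/eqP; lia.
  rewrite (pr_independent (pc _ _) (process_and (pc _ _) pj) (pc _ _)).
  rewrite -mulrA ler_wpM2r//; last by rewrite (pr_count).
  apply: mulr_ge0; apply: pr_ge0; last exact: (event_process (pc rightpos k)).
  exact: (event_and (eC _) ej).
rewrite -mulr_sumr ler_wpM2l// lerBrDr.
apply: has_mean_le (has_meanD (has_mean_sum r.+1 (fun k => has_mean_event P (eG k)))
  (has_mean_event P (event_exceed r s0))) (has_mean_event P (event_exceed r u0)) _.
apply: filterS (ae_mono s0 su) => w [_ cc mm].
rewrite (sum_pred1 R (fun k => (C s w == r - k)%N && jump middle s u w)).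
rewrite -natrD ler_nat /jump.
case: (ltnP (C s w) (C u w)) => cj; rewrite ?andbF ?andbT /=; last by lia.
case: (leqP (M s w) r) => mr /=; last by lia.
by case: eqP; lia.
Qed.

Lemma balance_le0 r t : 0 <= t -> balance r t <= 0.
Proof.
move=> t0; apply: (@le_trans _ _ (balance r 0)).
  apply: (nonincreasing_quadratic (c := 60) t0) => s u s0 su _.
  have := balance_step r s0 su; rewrite ler_norml => /andP[_].
  have := pr_ge0 P (event_and (event_tied r s0) (event_jump middle s0 su)).
  lra.
rewrite /balance (_ : pr P (center_filled r 0) = 0).
  have := pr_ge0 P (event_top_layer (leq r.+1) (lexx 0)); lra.
apply: etrans (pr_cst P false); apply: ae_pr_eq.
- exact: event_center_filled.
- exact: observable_cst.
- by apply: filterS ae_good_path => w [[k0 _ _] _ _]; exact: k0.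
Qed.

(** At time t0 the balance is at least - P(H_t0 > r), by its definition.  Afterwards
    it loses at most eps times the increment of [exceed]. *)
Lemma balance_ge r t0 t eps : 0 < t0 -> t0 <= t -> 0 <= eps ->
  (forall s m, t0 <= s -> poisson_pmf s m <= eps) ->
  - balance r t <= pr P (fun w => r < top_layer t0 w)%N + eps.
Proof.
move=> t00 tt e0 small.
have : - balance r t - eps * exceed r t <= - balance r t0 - eps * exceed r t0.
  apply: (@nonincreasing_quadratic R (fun s => - balance r s - eps * exceed r s) 60 t0 t tt).
  move=> s u ts su _.
  have s0 : 0 < s by apply: lt_le_trans ts.
  have := balance_step r (ltW s0) su; rewrite ler_norml => /andP[+ _].
  have := tied_jump_bound r s0 su e0 (fun m => small s m ts).
  lra.
have t0' := le_trans (ltW t00) tt.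
have F1 : exceed r t <= 1 := pr_le1 P (event_exceed r t0').
have F0 : 0 <= exceed r t0 := pr_ge0 P (event_exceed r (ltW t00)).
have k0 : 0 <= pr P (center_filled r t0) := pr_ge0 P (event_center_filled r (ltW t00)).
have h1 : eps * exceed r t <= eps by rewrite ler_piMr.
have h2 : 0 <= eps * exceed r t0 by rewrite mulr_ge0.
rewrite {2}/balance; lra.
Qed.

(** H is at least C, and C takes each of the values 0, ..., r with probability at
    most eps. *)
Lemma top_layer_unbounded r t eps : 0 < t ->
  (forall m, poisson_pmf t m <= eps) ->
  1 - r.+1%:R * eps <= pr P (fun w => r < top_layer t w)%N.
Proof.
move=> t0 small.
have eC : event (fun w => C t w <= r)%N.
  exact: (observable_op1 sG (leq^~ r) (observable_count middle (ltW t0))).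
have et := event_top_layer (leq r.+1) (ltW t0).
have h : pr P (fun w => C t w <= r)%N <= r.+1%:R * eps.
  rewrite (pr_split P (l := r) eC (observable_count middle (ltW t0)))//.
  rewrite -[r.+1 in X in _ <= X]card_ord mulr_natl -sumr_const.
  apply: ler_sum => k _; apply: le_trans (small k).
  rewrite -(pr_count k active_middle t0); apply: ae_pr_le.
  - exact: event_and eC (observable_op1 sG (eq_op^~ (k : nat)) (observable_count middle (ltW t0))).
  - exact: (observable_op1 sG (eq_op^~ (k : nat)) (observable_count middle (ltW t0))).
  by apply: aeW => w /andP[].
have := has_mean_le (has_mean_event P (observable_cst sG true))
  (has_meanD (has_mean_event P eC) (has_mean_event P et)) _.
rewrite pr_cst /= => /(_ _)/wrap[].
  apply: aeW => w; rewrite -natrD ler_nat /top_layer /height /counts /layers; lia.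
lra.
Qed.

Lemma top_layer_tight t eps : 0 <= t -> 0 < eps ->
  \forall r \near \oo, pr P (fun w => r < top_layer t w)%N <= eps.
Proof.
move=> t0 e0.
pose F r := [set w | (r < top_layer t w)%N].
have et r := event_top_layer (leq r.+1) t0.
have mF r : measurable (F r) := event_measurable (et r).
have F0 : \bigcap_r F r = set0.
  by rewrite -subset0 => w /(_ (top_layer t w) I); rewrite /F /= ltnn.
have cv : (P \o F) r @[r --> \oo] --> P (\bigcap_r F r).
  apply: nonincreasing_cvg_mu => //.
  - by rewrite -[X in (X < _)%E]/(P [set w | (0 < top_layer t w)%N]) (prE P (et 0%N)) ltry.
  - by rewrite F0.
  - by move=> m n mn; apply/subsetPset => w; rewrite /F /=; exact: leq_ltn_trans.
rewrite F0 measure0 in cv.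
have {}cv : pr P (fun w => r < top_layer t w)%N @[r --> \oo] --> (0 : R).
  move: cv; rewrite (_ : P \o F = fun r => (pr P (fun w => r < top_layer t w)%N)%:E).
    by move=> /fine_cvg.
  by apply/funext => r; exact: (prE P (et r)).
have /cvgrPdist_le/(_ _ e0) := cv.
apply: filterS => r; rewrite sub0r normrN; exact: le_trans (ler_norm _).
Qed.

Lemma densityE r t : 0 <= t ->
  density P kappa t middle r.+1 = (pr P (center_filled r t))%:E.
Proof.
move=> t0; rewrite /density unlock.
exact: (has_mean_event P (event_center_filled r t0)).2.
Qed.

Lemma center_filled_nondecreasing r s u : 0 <= s -> s <= u ->
  pr P (center_filled r s) <= pr P (center_filled r u).
Proof.
move=> s0 su; rewrite -lerN2.
apply: (@nonincreasing_quadratic R (fun s => - pr P (center_filled r s)) 6 s u su).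
move=> a b sa ab _.
have := pr_center_filled_step r (le_trans s0 sa) ab; lra.
Qed.

(** * Convergence of the densities *)

(** The measurability of the configuration, hence the value of the density, is
    only available for nonnegative times; the extension to negative times by the
    value at 0 is monotone and bounded. *)
Lemma density_cvg r : cvg (density P kappa t middle r.+1 @[t --> +oo%R]).
Proof.
pose f t := pr P (center_filled r (Num.max t 0)).
have m0 t : 0 <= Num.max t 0 :> R by rewrite le_max lexx orbT.
have : f t @[t --> +oo] --> sup (range f).
  apply: nondecreasing_cvgr.
    move=> s u su; apply: center_filled_nondecreasing => //.
    by rewrite ge_max le_max su m0.
  exists 1 => _ [t _ <-]; apply: pr_le1; exact: event_center_filled.
move=> cv; apply/cvg_ex; exists (sup (range f))%:E.
have {}cv : (f t)%:E @[t --> +oo] --> (sup (range f))%:E by apply/fine_cvgP; split=> //; exact: nearW.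
apply: cvg_trans cv; apply: near_eq_cvg.
near=> t; rewrite /f densityE.
  by rewrite max_l//; near: t; exact: nbhs_pinfty_ge.
by near: t; exact: nbhs_pinfty_ge.
Unshelve. all: by end_near. Qed.

End parking_process.

Unset Implicit Arguments.

Theorem theorem2 (R : realType) (d : measure_display) (T : measurableType d)
    (P : probability T R) (N : position -> R -> T -> nat)
    (kappa : R -> T -> config) :
  parking_system P N kappa ->
  (forall r : nat, (1 <= r)%N ->
     cvg (density P kappa t middle r @[t --> +oo%R])) /\
  end_density P kappa r @[r --> \oo] --> ((2^-1 : R)%:E).
Proof.
move=> PS; split; first by move=> [//|r _]; exact: density_cvg PS r.
have half r : (end_density P kappa r.+1 <= (2^-1 : R)%:E)%E.
  apply: lime_le; first exact: density_cvg PS r.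
  near=> t.
  have t0 : 0 <= t by near: t; exact: nbhs_pinfty_ge.
  rewrite (densityE PS)// lee_fin.
  have := balance_le0 PS r t0; rewrite /balance.
  have := pr_le1 P (event_top_layer PS (leq r.+1) t0); lra.
have low (e : R) : 0 < e ->
    \forall r \near \oo, ((2^-1 - e)%:E <= end_density P kappa r.+1)%E.
  move=> e0; have e2 : 0 < e / 2 by rewrite divr_gt0.
  have [t0 t00 small] := poisson_pmf_small e2.
  apply: filterS (top_layer_tight PS (ltW t00) e2) => r tight.
  apply: lime_ge; first exact: density_cvg PS r.
  (* The bound on P(H <= r) is r + 1 times the one on the Poisson masses. *)
  have er : 0 < e / 2 / r.+1%:R by rewrite divr_gt0// ltr0n.
  have [t1 t10 smaller] := poisson_pmf_small er.
  near=> t.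
  have tt0 : t0 <= t by near: t; exact: nbhs_pinfty_ge (num_real _).
  have tt1 : t1 <= t by near: t; exact: nbhs_pinfty_ge (num_real _).
  have t_gt0 : 0 < t by exact: lt_le_trans tt0.
  rewrite (densityE PS r (ltW t_gt0)) lee_fin.
  have := balance_ge PS r t00 tt0 (ltW e2) (fun s m ts => small s m ts).
  have := top_layer_unbounded PS r t_gt0 (fun m => smaller t m tt1).
  rewrite mulrC divfK ?gt_eqF ?ltr0n// /balance; lra.
(* Layer 0 never holds a particle: the sequence is read from layer 1 on. *)
rewrite -cvg_shiftS; apply/fine_cvgP; split.
  apply: filterS (low 1 ltr01) => r h; rewrite fin_numElt.
  apply/andP; split; first exact: lt_le_trans (ltNyr _) h.
  exact: le_lt_trans (half r) (ltry _).
apply/cvgrPdist_le => e e0; apply: filterS2 (low e e0) (low 1 ltr01) => r h _ /=.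
have fr : end_density P kappa r.+1 \is a fin_num.
  rewrite fin_numElt; apply/andP; split; first exact: lt_le_trans (ltNyr _) h.
  exact: le_lt_trans (half r) (ltry _).
move: h (half r); rewrite -(fineK fr) !lee_fin => h1 h2.
rewrite ger0_norm; lra.
Unshelve. all: by end_near. Qed.
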